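(* Let $\mathtt z>0$ satisfy $\mathtt z\le\mathfrak g^2/4$, and suppose that conditions (I), (ED0), (L0), (C) below hold. Then with probability at least $1-(2e^{-\mathtt z}+8.4e^{-\mathfrak g^2/4})$ one has $\widetilde\theta\in\Theta_n(\mathtt z)$ and $$\|D_n(\widetilde\theta-\theta^* )-\xi\|\le\diamondsuit(n,\mathtt z):=\mathtt r_0(\mathtt z)\,\delta_n(\mathtt r_0(\mathtt z)).$$
   Context: Setting. Fix integers $d,p\ge1$, $n\ge1$, a bandwidth $h>0$ and a point $x_0\in\mathbb R^d$. Let $X_1,\dots,X_n$ be i.i.d. random vectors in $\mathbb R^d$ with Lebesgue density $f$. Let $K:\mathbb R^d\to[0,\infty)$ be a bounded measurable kernel vanishing outside $[-1,1]^d$, and let $\psi_0,\dots,\psi_{p-1}:[-1,1]^d\to\mathbb R$ be bounded measurable functions with $\psi_0\equiv1$, linearly independent on $\{K>0\}$; write $\Psi(t)=(\psi_0(t),\dots,\psi_{p-1}(t))^\top$ (extended by $0$ outside $[-1,1]^d$). Put $T_i=(X_i-x_0)/h$ and define the local log-likelihood $$L(\theta)=\sum_{i=1}^n K(T_i)\Psi(T_i)^\top\theta-nh^d\int_{[-1,1]^d}K(t)\exp(\Psi(t)^\top\theta)\,dt,\qquad \theta\in\mathbb R^p.$$ Let $\widetilde\theta=\arg\max_\theta L(\theta)$ and $\theta^*=\arg\max_\theta \mathbf E L(\theta)$ (both assumed to exist). Define $D_n^2(\theta)=-\nabla^2\mathbf E L(\theta)=nh^d\int K(t)\Psi(t)\Psi(t)^\top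 e^{\Psi(t)^\top\theta}dt$, $D_n^2=D_n^2(\theta^* )$ with $D_n$ its symmetric positive definite square root, score vector $\xi=D_n^{-1}\nabla L(\theta^* )$, and $V_n^2=\mathrm{Var}(\nabla L(\theta^* ))$ (assumed positive definite). Set $\zeta(p,\mathtt z)=\mathfrak a\nu_0(\sqrt p+\sqrt{2\mathtt z})$, $\mathtt r_0(\mathtt z)=4\mathfrak a\nu_0(\sqrt p+\sqrt{2\mathtt z})$ and $\Theta_n(\mathtt z)=\{\theta:\|D_n(\theta-\theta^* )\|\le\mathtt r_0(\mathtt z)\}$. $\|\cdot\|$ is the Euclidean norm on vectors and operator norm on matrices; $\succeq$ is the Loewner order. Conditions. (I): $\mathfrak a^2D_n^2\succeq V_n^2$ for a constant $\mathfrak a>0$. (ED0): there are $\mathfrak g,\nu_0>0$ such that with $\boldsymbol\zeta=V_n^{-1}\nabla L(\theta^* )-\mathbf E V_n^{-1}\nabla L(\theta^* )$, for all nonzero $\gamma\in\mathbb R^p$ and all $|\lambda|\le\mathfrak g$, $\log\mathbf E\exp(\lambda\gamma^\top\boldsymbol\zeta/\|\gamma\|)\le\nu_0^2\lambda^2/2$. (L0): there is $\delta_n(\mathtt r_0(\mathtt z))\ge0$ such that for all $\theta\in\Theta_n(\mathtt z)$, $\|I_p-D_n^{-1}D_n^2(\theta)D_n^{-1}\|\le\delta_n(\mathtt r_0(\mathtt z))$. (C): $\mathtt r_0(\mathtt z)\,(1-\delta_n(\mathtt r_0(\mathtt z)))\ge2\zeta(p,\mathtt z)$. *)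

(* Defs.v *)
From HB Require Import structures.
From mathcomp Require Import all_boot all_order all_algebra.
From mathcomp Require Import all_classical all_reals all_analysis.
Set Implicit Arguments. Unset Strict Implicit. Unset Printing Implicit Defensive.
Import Order.TTheory GRing.Theory Num.Theory.
Import numFieldNormedType.Exports.
Local Open Scope classical_set_scope.
Local Open Scope ring_scope.

Section Defs.
Variable R : realType.

(* Points of R^d are d-tuples of reals (with the product sigma-algebra of
   mathcomp-analysis); parameter vectors in R^p are column vectors 'cV_p. *)

(* d-dimensional Lebesgue integral of a nonnegative extended function,
   as the iterated (Tonelli) integral w.r.t. one-dimensional Lebesgue measure. *)
Fixpoint leb_int_nneg (d : nat) : (d.-tuple R -> \bar R) -> \bar R :=
  match d return (d.-tuple R -> \bar R) -> \bar R with
  | 0 => fun g => g [tuple]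
  | d'.+1 => fun g =>
      (\int[@lebesgue_measure R]_(x in [set: R])
          leb_int_nneg (fun y : d'.-tuple R => g [tuple of x :: y]))%E
  end.

(* d-dimensional Lebesgue integral of a real (integrable) function,
   as the iterated (Fubini) integral. *)
Fixpoint leb_Rint (d : nat) : (d.-tuple R -> R) -> R :=
  match d return (d.-tuple R -> R) -> R with
  | 0 => fun g => g [tuple]
  | d'.+1 => fun g =>
      Rintegral (@lebesgue_measure R) [set: R]
          (fun x => leb_Rint (fun y : d'.-tuple R => g [tuple of x :: y]))
  end.

Definition cube (d : nat) : set (d.-tuple R) :=
  [set t | forall k : 'I_d, -1 <= tnth t k <= 1].

Definition boxset (d : nat) (B : 'I_d -> set R) : set (d.-tuple R) :=
  [set t | forall k : 'I_d, B k (tnth t k)].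

Definition cdot (p : nat) (u v : 'cV[R]_p) : R := \sum_(j < p) u j ord0 * v j ord0.
Definition enorm (p : nat) (u : 'cV[R]_p) : R := Num.sqrt (cdot u u).

Definition opnorm_le (p : nat) (A : 'M[R]_p) (c : R) : Prop :=
  forall u : 'cV[R]_p, enorm (A *m u) <= c * enorm u.

Definition sym_posdef (p : nat) (A : 'M[R]_p) : Prop :=
  A^T = A /\ forall u : 'cV[R]_p, u != 0 -> 0 < cdot u (A *m u).

Definition loewner_le (p : nat) (A B : 'M[R]_p) : Prop :=
  forall u : 'cV[R]_p, cdot u (A *m u) <= cdot u (B *m u).

Definition rescale (d : nat) (x0 : d.-tuple R) (h : R) (x : d.-tuple R)
  : d.-tuple R := [tuple (tnth x k - tnth x0 k) / h | k < d].

Definition loglik (d p n : nat) (h : R) (x0 : d.-tuple R)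
  (K : d.-tuple R -> R) (Psi : d.-tuple R -> 'cV[R]_p)
  (X : 'I_n -> d.-tuple R) (th : 'cV[R]_p) : R :=
  \sum_(i < n) K (rescale x0 h (X i)) * cdot (Psi (rescale x0 h (X i))) th
  - n%:R * h ^+ d *
    leb_Rint (fun t => \1_(@cube d) t * (K t * expR (cdot (Psi t) th))).

Definition Dn2 (d p n : nat) (h : R) (K : d.-tuple R -> R)
  (Psi : d.-tuple R -> 'cV[R]_p) (th : 'cV[R]_p) : 'M[R]_p :=
  \matrix_(j, k) (n%:R * h ^+ d *
    leb_Rint (fun t => \1_(@cube d) t *
       (K t * Psi t j ord0 * Psi t k ord0 * expR (cdot (Psi t) th)))).

Definition grad (p : nat) (F : 'cV[R]_p -> R) (th : 'cV[R]_p) : 'cV[R]_p :=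
  \col_(j < p) (derive1 (fun s : R => F (th + s *: delta_mx j ord0)) 0).

End Defs.

(* Main.v *)
(** Two independent facts give the result.

    Deterministic part.  The second derivative of the log-likelihood does not
    depend on the data, so by the mean value theorem
    [<xi, w> = <w, D^-1 D^2(th) D^-1 u>] with [u = D (tht - ths)] and [th] on
    the segment from [ths] to [tht] (depending on [w]).  Concavity along this
    segment and (L0) show that [|xi| < r0 (1 - delta)] forces [|u| <= r0];
    taking [w = u - xi] then gives [|u - xi| <= delta |u|].  Since [r0 = 4 zeta],
    condition (C) makes [|xi| < 2 zeta] sufficient.

    Probabilistic part.  This factor 2 is essential: (ED0) controls exponential
    moments only up to [g], and gives the required bound for
    [Y = V^-1 gradL / nu0] at the level [2 (sqrt p + sqrt (2 z))] without any
    relation between [g] and [p].  One averages [exp (x . Y)] over an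
    approximately Gaussian [x] of variance [s] in each coordinate, truncated to
    [|x| <= g].  As Gaussian substitute serves the endpoint of a random walk with
    Rademacher steps, so that every average is a finite sum.  A variance [s] of
    order [min (1, g^2 / p)] works.  Rescaling by [nu0] keeps the radius [g]
    because [nu0 >= 1], which (ED0) implies as [V^-1 gradL] has identity
    covariance. *)
Require Import Defs.
From HB Require Import structures.
From mathcomp Require Import all_boot all_order all_algebra.
From mathcomp Require Import all_classical all_reals all_analysis.
From mathcomp Require Import measurable_realfun ring lra.
Import Order.TTheory GRing.Theory Num.Theory.
Import numFieldNormedType.Exports.
Set Implicit Arguments.
Unset Strict Implicit.
Unset Printing Implicit Defensive.
Local Open Scope classical_set_scope.
Local Open Scope ring_scope.

(** * Elementary inequalities for exponentials and hyperbolic functions *)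

Lemma ge0_derive_ge0 (R : realType) (f df : R -> R) (x : R) :
  (forall t : R, is_derive t 1 f (df t)) -> (forall t, 0 <= t -> 0 <= df t) ->
  0 <= x -> f 0 <= f x.
Proof.
move=> fdf df0 x0.
have cf : {within `[0, x], continuous f}.
  apply: continuous_subspaceT => t; apply: differentiable_continuous.
  by apply/derivable1_diffP; case: (fdf t).
have [c c0x fE] := MVT_segment x0 (fun t _ => fdf t) cf.
rewrite -subr_ge0 fE subr0 mulr_ge0// df0//.
by move: c0x; rewrite in_itv/= => /andP[].
Qed.

Lemma cosh_ge2 (R : realType) (x : R) : 2 <= expR x + expR (- x).
Proof.
have := sqr_ge0 (expR (x / 2) - expR (- (x / 2))).
have -> : expR x = expR (x / 2) ^+ 2 by rewrite -expRM_natl; congr expR; field.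
have -> : expR (- x) = expR (- (x / 2)) ^+ 2.
  by rewrite -expRM_natl; congr expR; field.
have := expRxMexpNx_1 (x / 2).
by move: (expR _) (expR _) => u v uv; rewrite sqrrB; lra.
Qed.

Lemma sinh_ge (R : realType) (x : R) :
  0 <= x -> 2 * x <= expR x - expR (- x).
Proof.
move=> x0.
have H (t : R) : is_derive t 1 (fun x => expR x - expR (- x) - 2 * x : R)
    (expR t + expR (- t) - 2).
  by apply: is_derive_eq; rewrite /GRing.scale/=; ring.
have := @ge0_derive_ge0 _ _ _ x H.
rewrite oppr0 expR0 => /(_ _ x0) h.
suff : 0 <= expR x - expR (- x) - 2 * x by lra.
apply: le_trans (h _); first by rewrite subrr mulr0 subrr.
by move=> t _; rewrite subr_ge0 cosh_ge2.
Qed.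

(** Since [cosh x - 1 = 2 sinh(x/2)^2], it is enough to square [sinh_ge] at [x / 2]. *)
Lemma cosh_ge (R : realType) (x : R) : 1 + x ^+ 2 / 2 <= (expR x + expR (- x)) / 2.
Proof.
wlog x0 : x / 0 <= x.
  move=> H; have [|/ltW x0] := leP 0 x; first exact: H.
  have := H (- x); rewrite opprK sqrrN oppr_ge0 addrC [X in _ <= X / _]addrC.
  rewrite addrC; exact.
have x20 : 0 <= x / 2 by rewrite divr_ge0.
have h : x ^+ 2 <= (expR (x / 2) - expR (- (x / 2))) ^+ 2.
  rewrite ler_sqr ?nnegrE//; last by rewrite (le_trans _ (sinh_ge x20))//; lra.
  by rewrite (le_trans _ (sinh_ge x20))//; lra.
have -> : expR x = expR (x / 2) ^+ 2 by rewrite -expRM_natl; congr expR; field.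
have -> : expR (- x) = expR (- (x / 2)) ^+ 2.
  by rewrite -expRM_natl; congr expR; field.
have := expRxMexpNx_1 (x / 2).
by move: h; move: (expR _) (expR _) => u v + uv; rewrite sqrrB; lra.
Qed.

Lemma cosh_le (R : realType) (x : R) :
  (expR x + expR (- x)) / 2 <= expR (x ^+ 2 / 2).
Proof.
wlog x0 : x / 0 <= x.
  move=> H; have [|/ltW x0] := leP 0 x; first exact: H.
  by have := H (- x); rewrite opprK sqrrN oppr_ge0 [X in X / _ <= _]addrC; apply.
(* [k t] is [2 (t cosh t - sinh t)], the numerator of the derivative of [- 2 cosh t exp(- t^2 / 2)];
   it vanishes at 0 and its own derivative is [2 t sinh t]. *)
pose k (t : R) := (t - 1) * expR t + (t + 1) * expR (- t).
have dk (t : R) : is_derive t 1 k (t * (expR t - expR (- t))).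
  by rewrite /k; apply: is_derive_eq; rewrite /GRing.scale/=; ring.
have k0 (t : R) : 0 <= t -> 0 <= k t.
  move=> t0; have := @ge0_derive_ge0 _ _ _ t dk.
  rewrite {1}/k oppr0 expR0 => /(_ _ t0) h; apply: le_trans (h _); first lra.
  move=> u u0; rewrite mulr_ge0// (le_trans _ (sinh_ge u0))//; lra.
pose h (t : R) := - (expR t + expR (- t)) * expR (- (t ^+ 2 / 2)).
have dh (t : R) : is_derive t 1 h (expR (- (t ^+ 2 / 2)) * k t).
  by rewrite /h; apply: is_derive_eq; rewrite /k /GRing.scale/= mulr0; field.
have := @ge0_derive_ge0 _ _ _ x dh.
move=> /(_ _ x0) H; have {}H : h 0 <= h x.
  by apply: H => t t0; rewrite mulr_ge0// ?expR_ge0// k0.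
move: H; rewrite /h oppr0 expr0n/= mul0r oppr0 expR0 => H.
have := expRxMexpNx_1 (x ^+ 2 / 2); have := expR_gt0 (x ^+ 2 / 2).
have := expR_gt0 (- (x ^+ 2 / 2)).
move: H; move: (expR (- (_ / _))) (expR (_ / _)) (_ + expR _) => u v w H u0 v0 uv.
have -> : w = w * u * v by rewrite -mulrA [u * v]mulrC uv mulr1.
have : w * u <= 2 by lra.
by move=> /(ler_wpM2r (ltW v0)); lra.
Qed.

Lemma cosh_scale_le (R : realType) (k x : R) : 0 <= k <= 1 ->
  expR (k * x) + expR (- (k * x)) <= expR x + expR (- x).
Proof.
move=> /andP[k0 k1].
wlog x0 : x / 0 <= x.
  move=> H; have [|/ltW x0] := leP 0 x; first exact: H.
  have := H (- x); rewrite mulrN !opprK oppr_ge0.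
  by rewrite (addrC (expR (- (k * x)))) (addrC (expR (- x))); exact.
have kx : k * x <= x by rewrite ler_piMl.
have kx0 : 0 <= k * x by rewrite mulr_ge0.
have h1 : expR (k * x) <= expR x by rewrite ler_expR.
have h2 : expR (- (k * x)) * expR (- x) <= 1.
  by rewrite -expRD expR_le1; lra.
(* Expanded with [e^x e^-x = 1], this product is exactly the difference of the two sides. *)
have : 0 <= (expR x - expR (k * x)) * (1 - expR (- (k * x)) * expR (- x)).
  by rewrite mulr_ge0// subr_ge0.
have := expRxMexpNx_1 x; have := expRxMexpNx_1 (k * x).
move: (expR x) (expR (- x)) (expR (k * x)) (expR (- (k * x))) => a b c d.
move=> cd ab.
have -> : (a - c) * (1 - d * b) = a - c - d * (a * b) + b * (c * d) by ring.
by rewrite ab cd; lra.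
Qed.

(** The function [(1 + t) exp(t^2 / 2 - t)] has derivative [t^2 exp(t^2 / 2 - t) >= 0] and equals 1
    at 0. *)
Lemma expR_sub_sqr_le (R : realType) (u : R) :
  0 <= u -> expR (u - u ^+ 2 / 2) <= 1 + u.
Proof.
move=> u0.
pose f (t : R) := (1 + t) * expR (t ^+ 2 / 2 - t).
have df (t : R) : is_derive t 1 f (expR (t ^+ 2 / 2 - t) * t ^+ 2).
  by rewrite /f; apply: is_derive_eq; rewrite /GRing.scale/= mulr0; field.
have : f 0 <= f u.
  by apply: ge0_derive_ge0 df _ u0 => t _; rewrite mulr_ge0// ?expR_ge0// sqr_ge0.
rewrite /f addr0 expr0n/= mul0r subrr expR0 mul1r.
have -> : u - u ^+ 2 / 2 = - (u ^+ 2 / 2 - u) by ring.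
have := expRxMexpNx_1 (u ^+ 2 / 2 - u).
have := expR_gt0 (- (u ^+ 2 / 2 - u)).
set a := expR (- _); set b := expR _ => a0 ab.
by move=> /(ler_wpM2r (ltW a0)); rewrite mul1r -mulrA ab mulr1.
Qed.

(** * Euclidean inner product and norm on column vectors *)

Section cdot.
Context {R : realType} {p : nat}.
Implicit Types (u v w : 'cV[R]_p) (k : R).

Lemma cdotC u v : cdot u v = cdot v u.
Proof. by apply: eq_bigr => j _; rewrite mulrC. Qed.

Lemma cdotDl u v w : cdot (u + v) w = cdot u w + cdot v w.
Proof. by rewrite -big_split; apply: eq_bigr => j _; rewrite mxE mulrDl. Qed.

Lemma cdotZl k u w : cdot (k *: u) w = k * cdot u w.
Proof. by rewrite mulr_sumr; apply: eq_bigr => j _; rewrite mxE mulrA. Qed.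

Lemma cdotDr u v w : cdot w (u + v) = cdot w u + cdot w v.
Proof. by rewrite cdotC cdotDl !(cdotC w). Qed.

Lemma cdotZr k u w : cdot w (k *: u) = k * cdot w u.
Proof. by rewrite cdotC cdotZl (cdotC w). Qed.

Lemma cdotNl u w : cdot (- u) w = - cdot u w.
Proof. by rewrite -scaleN1r cdotZl mulN1r. Qed.

Lemma cdotNr u w : cdot w (- u) = - cdot w u.
Proof. by rewrite cdotC cdotNl cdotC. Qed.

Lemma cdotBl u v w : cdot (u - v) w = cdot u w - cdot v w.
Proof. by rewrite cdotDl cdotNl. Qed.

Lemma cdotBr u v w : cdot w (u - v) = cdot w u - cdot w v.
Proof. by rewrite cdotDr cdotNr. Qed.

Lemma cdot0l w : cdot 0 w = 0.
Proof. by rewrite -(scale0r 0) cdotZl mul0r. Qed.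

Lemma cdot_ge0 u : 0 <= cdot u u.
Proof. by apply: sumr_ge0 => j _; rewrite -expr2 sqr_ge0. Qed.

Lemma cdot_eq0 u : (cdot u u == 0) = (u == 0).
Proof.
apply/eqP/eqP => [u0|->]; last exact: cdot0l.
have /psumr_eq0P h : forall j : 'I_p, true -> 0 <= u j ord0 * u j ord0.
  by move=> j _; rewrite -expr2 sqr_ge0.
apply/matrixP => j i; rewrite ord1 mxE.
by have /eqP := h u0 j isT; rewrite mulf_eq0 orbb => /eqP.
Qed.

Lemma enorm_ge0 u : 0 <= enorm u. Proof. exact: sqrtr_ge0. Qed.

Lemma enorm_sqr u : enorm u ^+ 2 = cdot u u.
Proof. by rewrite sqr_sqrtr// cdot_ge0. Qed.

Lemma enorm_gt0 u : (0 < enorm u) = (u != 0).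
Proof. by rewrite sqrtr_gt0 lt_def cdot_eq0 cdot_ge0 andbT. Qed.

Lemma enormZ k u : enorm (k *: u) = `|k| * enorm u.
Proof.
by rewrite /enorm cdotZl cdotZr mulrA -expr2 sqrtrM ?sqr_ge0// sqrtr_sqr.
Qed.

Lemma cdot_le_enorm u v : cdot u v <= enorm u * enorm v.
Proof.
have [->|u0] := eqVneq u 0.
  by rewrite cdot0l mulr_ge0// enorm_ge0.
have [->|v0] := eqVneq v 0.
  by rewrite cdotC cdot0l mulr_ge0// enorm_ge0.
rewrite -!enorm_gt0 in u0 v0.
have := cdot_ge0 (enorm v *: u - enorm u *: v).
rewrite !(cdotBl, cdotBr, cdotZl, cdotZr) -!enorm_sqr (cdotC v u).
move: (enorm u) (enorm v) (cdot u v) u0 v0 => a b c a0 b0 h.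
rewrite -subr_ge0 -(pmulr_rge0 _ (mulr_gt0 a0 b0)); lra.
Qed.

Lemma cdot_trmx (A : 'M[R]_p) u v : cdot u (A *m v) = cdot (A^T *m u) v.
Proof.
rewrite /cdot; under eq_bigr do rewrite mxE mulr_sumr.
rewrite exchange_big/=; apply: eq_bigr => k _.
by rewrite mxE mulr_suml; apply: eq_bigr => j _; rewrite mxE; ring.
Qed.

End cdot.

(** * A random walk as Gaussian substitute *)

Section walk.
Context {R : realType} {p : nat}.
Implicit Types (x y u : 'cV[R]_p) (F G : 'cV[R]_p -> R) (tau c : R).

Definition signv (e : {ffun 'I_p -> bool}) : 'cV[R]_p := \col_j (-1) ^+ e j.

(** Endpoints are listed with multiplicity, one entry per sequence of [m] sign vectors, so the plain
    average over the list is the expectation under the walk. *)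
Fixpoint walk tau m : seq 'cV[R]_p :=
  if m is m'.+1 then
    [seq x + tau *: signv e | x <- walk tau m', e <- index_enum {ffun 'I_p -> bool}]
  else [:: 0].

Definition wmean tau m F : R := (2 ^+ p) ^- m * \sum_(x <- walk tau m) F x.

Definition smean F : R := (2 ^+ p)^-1 * \sum_e F (signv e).

Lemma wmean0 tau F : wmean tau 0 F = F 0.
Proof. by rewrite /wmean big_seq1 expr0 invr1 mul1r. Qed.

Lemma wmeanS tau m F :
  wmean tau m.+1 F = wmean tau m (fun x => smean (fun s => F (x + tau *: s))).
Proof.
rewrite /wmean /= big_allpairs_dep exprS invfM [_^-1 * _]mulrC -mulrA; congr (_ * _).
by rewrite mulr_sumr.
Qed.

Lemma wmean_le tau m F G : (forall x, F x <= G x) -> wmean tau m F <= wmean tau m G.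
Proof.
move=> FG; apply: ler_wpM2l; first by rewrite invr_ge0 !exprn_ge0.
exact: ler_sum.
Qed.

Lemma smean_le F G : (forall x, F x <= G x) -> smean F <= smean G.
Proof.
move=> FG; apply: ler_wpM2l; first by rewrite invr_ge0 exprn_ge0.
exact: ler_sum.
Qed.

Lemma eq_wmean tau m F G : F =1 G -> wmean tau m F = wmean tau m G.
Proof. by move=> FG; rewrite /wmean; under eq_bigr do rewrite FG. Qed.

Lemma wmeanZ tau m c F : wmean tau m (fun x => c * F x) = c * wmean tau m F.
Proof. by rewrite /wmean -mulr_sumr mulrCA. Qed.

Lemma wmeanD tau m F G :
  wmean tau m (fun x => F x + G x) = wmean tau m F + wmean tau m G.
Proof. by rewrite /wmean big_split mulrDr. Qed.

Lemma smeanZ c F : smean (fun x => c * F x) = c * smean F.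
Proof. by rewrite /smean -mulr_sumr mulrCA. Qed.

(** The coordinates of a step are independent signs: distributing the product over the sum turns the
    mean of the exponential into a product of hyperbolic cosines. *)
Lemma smean_exp u :
  smean (fun s => expR (cdot s u)) =
  \prod_j ((expR (u j ord0) + expR (- u j ord0)) / 2).
Proof.
rewrite big_split/= prodr_const card_ord exprVn mulrC; congr (_ * _).
pose f j (b : bool) := expR ((-1) ^+ b * u j ord0).
transitivity (\prod_j \sum_b f j b).
  rewrite bigA_distr_bigA/=; apply: eq_bigr => e _.
  rewrite /cdot expR_sum; apply: eq_bigr => j _.
  by rewrite /f mxE.
by apply: eq_bigr => j _; rewrite big_bool /f expr1 expr0 mul1r mulN1r addrC.
Qed.

Lemma cdot_signv e : cdot (signv e) (signv e) = p%:R.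
Proof.
rewrite /cdot; under eq_bigr do rewrite mxE -expr2 sqrr_sign.
by rewrite sumr_const card_ord.
Qed.

(** A sign vector has squared norm exactly [p], so in [|u + tau s|^2] only the cross term is random;
    its exponential moment is bounded coordinatewise by [cosh_le]. *)
Lemma smean_quad tau c u : 0 <= c ->
  smean (fun s => expR (c / 2 * cdot (u + tau *: s) (u + tau *: s))) <=
  expR (c * tau ^+ 2 * p%:R / 2 + (c + c ^+ 2 * tau ^+ 2) / 2 * cdot u u).
Proof.
move=> c0.
have -> : smean (fun s => expR (c / 2 * cdot (u + tau *: s) (u + tau *: s))) =
   expR (c * tau ^+ 2 * p%:R / 2 + c / 2 * cdot u u) *
   smean (fun s => expR (cdot s ((c * tau) *: u))).
  rewrite -smeanZ /smean; congr (_ * _); apply: eq_bigr => e _.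
  rewrite -expRD; congr expR.
  by rewrite !(cdotDl, cdotDr, cdotZl, cdotZr) cdot_signv (cdotC _ u); field.
have -> : c * tau ^+ 2 * p%:R / 2 + (c + c ^+ 2 * tau ^+ 2) / 2 * cdot u u =
    c * tau ^+ 2 * p%:R / 2 + c / 2 * cdot u u + cdot ((c * tau) *: u) ((c * tau) *: u) / 2.
  by rewrite cdotZl cdotZr; field.
rewrite [leRHS]expRD ler_wpM2l ?expR_ge0// smean_exp /cdot mulr_suml expR_sum.
apply: ler_prod => j _; rewrite -expr2 cosh_le andbT.
by rewrite divr_ge0// addr_ge0// expR_ge0.
Qed.

(* Each step maps [c] to [c + c^2 tau^2 <= c / (1 - c tau^2)]; iterating the
   latter map [m] times gives [c / (1 - c m tau^2)]. *)
Lemma wmean_quad tau m c y : 0 <= c -> c * (m%:R * tau ^+ 2) < 1 ->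
  wmean tau m (fun x => expR (c / 2 * cdot (y + x) (y + x))) <=
  expR ((p%:R * (m%:R * tau ^+ 2) + cdot y y) / 2 *
        (c / (1 - c * (m%:R * tau ^+ 2)))).
Proof.
elim: m c => [|m IH] c c0 cm.
  by rewrite wmean0 addr0 mul0r !mulr0 add0r subr0 divr1 mulrC mulrA mulrAC.
have t0 := sqr_ge0 tau.
have m0 : 0 <= m%:R * tau ^+ 2 :> R by rewrite mulr_ge0.
rewrite -natr1 mulrDl mul1r in cm *.
set t := tau ^+ 2 in t0 m0 cm *; set M := m%:R * t in m0 cm *.
have ct0 : 0 <= c * t by rewrite mulr_ge0.
have cM0 : 0 <= c * M by rewrite mulr_ge0.
have ct1 : 0 < 1 - c * t by lra.
have cd : 0 < 1 - c * (M + t) by lra.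
pose c' := c / (1 - c * t).
have c'0 : 0 <= c' by rewrite divr_ge0// ltW.
have c'c : c + c ^+ 2 * t <= c'.
  rewrite /c' ler_pdivlMr//.
  have : 0 <= c * (c * t) ^+ 2 by rewrite mulr_ge0 ?sqr_ge0.
  by lra.
have c'M : 1 - c' * M = (1 - c * (M + t)) / (1 - c * t).
  by rewrite /c'; field; rewrite gt_eqF.
(* The last step is averaged first; it replaces [c] by [c'] at the price of a constant factor, and
   the induction hypothesis is then used at [c']. *)
rewrite wmeanS; apply: (@le_trans _ _ (wmean tau m (fun x =>
    expR (c * t * p%:R / 2) * expR (c' / 2 * cdot (y + x) (y + x))))).
  apply: wmean_le => x; rewrite -expRD.
  apply: le_trans (@smean_le _ (fun s =>
    expR (c / 2 * cdot (y + x + tau *: s) (y + x + tau *: s))) _) _.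
    by move=> s; rewrite addrA.
  apply: le_trans (smean_quad tau (y + x) c0) _.
  by rewrite ler_expR lerD2l ler_wpM2r ?cdot_ge0// ler_wpM2r.
rewrite wmeanZ.
have cM1 : c' * M < 1 by rewrite -subr_gt0 c'M divr_gt0.
apply: le_trans (ler_wpM2l (expR_ge0 _) (IH _ c'0 cM1)) _.
rewrite -expRD ler_expR -/t -/M c'M /c'.
have -> : c / (1 - c * t) / ((1 - c * (M + t)) / (1 - c * t)) = c / (1 - c * (M + t)).
  by field; rewrite !gt_eqF.
set q := c / _.
(* This absorbs the constant factor: its exponent [c t p / 2] is at most [q t p / 2], the share of
   the last step in the target. *)
have : c <= q.
  rewrite /q ler_pdivlMr//.
  have : 0 <= c * (c * (M + t)) by rewrite !mulr_ge0// addr_ge0.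
  by lra.
have pt : 0 <= p%:R * t / 2 :> R by rewrite mulr_ge0// mulr_ge0.
move=> /(ler_wpM2l pt).
lra.
Qed.

Lemma wmean_exp tau m y :
  wmean tau m (fun x => expR (cdot x y)) = (smean (fun s => expR (tau * cdot s y))) ^+ m.
Proof.
elim: m => [|m IH]; first by rewrite wmean0 cdot0l expR0 expr0.
rewrite wmeanS exprS -IH -wmeanZ; apply: eq_wmean => x.
rewrite mulrC -smeanZ /smean; congr (_ * _); apply: eq_bigr => e _.
by rewrite -expRD cdotDl cdotZl.
Qed.

(** Per coordinate, [cosh x >= 1 + x^2 / 2 >= exp(x^2 / 2 - x^4 / 8)], and the sum of fourth powers
    is at most [|y|^4]. With [m + 1] steps of variance [s / (m + 1)], the loss against the Gaussian
    value [exp(s |y|^2 / 2)] is of order [1 / (m + 1)] in the exponent. *)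
Lemma wmean_exp_ge s m y : 0 <= s ->
  expR (s * cdot y y / 2 - s ^+ 2 * cdot y y ^+ 2 / (8 * m.+1%:R)) <=
  wmean (Num.sqrt (s / m.+1%:R)) m.+1 (fun x => expR (cdot x y)).
Proof.
move=> s0; set tau := Num.sqrt _; set N : R := m.+1%:R.
have N0 : 0 < N by rewrite ltr0n.
have tE : tau ^+ 2 = s / N by rewrite sqr_sqrtr// divr_ge0// ltW.
rewrite wmean_exp [X in expR X](_ : _ = m.+1%:R *
    (cdot (tau *: y) (tau *: y) / 2 - cdot (tau *: y) (tau *: y) ^+ 2 / 8)); last first.
  rewrite !cdotZl !cdotZr mulrA -expr2 tE -/N; field.
  by rewrite gt_eqF.
rewrite expRM_natl lerXn2r ?nnegrE ?expR_ge0//.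
  by rewrite mulr_ge0 ?invr_ge0 ?exprn_ge0// sumr_ge0// => e _; rewrite expR_ge0.
have -> : smean (fun s => expR (tau * cdot s y)) = smean (fun s => expR (cdot s (tau *: y))).
  by rewrite /smean; under eq_bigr do rewrite -cdotZr.
rewrite smean_exp; move: (tau *: y) => {}y.
apply: (@le_trans _ _ (expR (\sum_j ((y j ord0 ^+ 2) / 2 - (y j ord0 ^+ 2 / 2) ^+ 2 / 2)))).
  have yE : cdot y y = \sum_j y j ord0 ^+ 2 by apply: eq_bigr => j _; rewrite expr2.
  rewrite ler_expR sumrB -[X in _ <= X - _]mulr_suml -yE lerD2l lerN2.
  rewrite [in leRHS]expr2 [X in _ <= _ * X / _]yE.
  rewrite mulr_sumr mulr_suml; apply: ler_sum => j _.
  have : y j ord0 ^+ 2 <= cdot y y.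
    by rewrite yE (bigD1 j)//= lerDl sumr_ge0// => k _; rewrite sqr_ge0.
  by move=> /(ler_wpM2r (sqr_ge0 (y j ord0))); lra.
rewrite expR_sum; apply: ler_prod => j _; rewrite expR_ge0/=.
by apply: le_trans (expR_sub_sqr_le _) (cosh_ge _); rewrite divr_ge0// sqr_ge0.
Qed.

End walk.

(** * Tail bound for sub-Gaussian vectors *)

Section trunc.
Context {R : realType} {p : nat}.
Implicit Types (x y : 'cV[R]_p) (s T g : R).

(** The full average is at least twice the claimed bound. The part with [|x| > g] is at most [k]
    times the average of [exp(|y + x|^2 / 2)], which [wmean_quad] at [c = 1] controls; it uses up at
    most half of the full average. *)
Lemma wmean_trunc_ge s T g m y : 0 < s -> s <= 1 / 4 -> cdot y y = T ->
  p%:R * s + s ^+ 2 * T <= g ^+ 2 / 2 -> 8 <= g ^+ 2 ->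
  s ^+ 2 * T ^+ 2 / (8 * m.+1%:R) <= 1 / 3 ->
  expR (s * T / 2 - 1 / 3) / 2 <= wmean (Num.sqrt (s / m.+1%:R)) m.+1
    (fun x => (cdot x x <= g ^+ 2)%R%:R * expR (cdot x y)).
Proof.
move=> s0 s4 yT sT g8 mT.
set tau := Num.sqrt _.
have mtau : m.+1%:R * tau ^+ 2 = s.
  rewrite sqr_sqrtr ?divr_ge0// 1?ltW//; field.
  by rewrite gt_eqF// ltr0n.
have T0 : 0 <= T by rewrite -yT cdot_ge0.
have H1 : expR (s * T / 2 - 1 / 3) <= wmean tau m.+1 (fun x => expR (cdot x y)).
  apply: le_trans (wmean_exp_ge _ _ (ltW s0)).
  by rewrite ler_expR yT lerD2l lerN2.
have H2 : wmean tau m.+1 (fun x => expR (1 / 2 * cdot (y + x) (y + x))) <=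
    expR ((p%:R * s + T) / 2 * (1 / (1 - s))).
  have := @wmean_quad R p tau m.+1 1 y ler01.
  by rewrite mtau yT mul1r; apply; lra.
pose k := expR (- (g ^+ 2 / 2) - T / 2).
(* [1 <= 1_{|x| <= g} + exp ((|x|^2 - g^2) / 2)] *)
have H3 : wmean tau m.+1 (fun x => expR (cdot x y)) <=
    wmean tau m.+1 (fun x => (cdot x x <= g ^+ 2)%R%:R * expR (cdot x y)) +
    k * wmean tau m.+1 (fun x => expR (1 / 2 * cdot (y + x) (y + x))).
  rewrite -wmeanZ -wmeanD; apply: wmean_le => x.
  case: (leP (cdot x x) (g ^+ 2)) => [_|xg].
    by rewrite /= mulr1n mul1r lerDl mulr_ge0// expR_ge0.
  rewrite /= mulr0n mul0r add0r -expRD ler_expR !(cdotDl, cdotDr) yT (cdotC y x).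
  by move: (cdot x x) (cdot x y) xg => a b; lra.
(* Write [T / (2 (1 - s))] as [T / 2 + s T / 2 + s^2 T / (2 (1 - s))]. As [1 / (1 - s) <= 4 / 3],
   the exponent on the left is at most [s T / 2 + g^2 / 3 - g^2 / 2], and [g^2 >= 8] gives
   [g^2 / 6 >= 1 / 3 + 1]. The extra 1 yields the factor [e^-1 <= 1 / 2]. *)
have H4 : k * expR ((p%:R * s + T) / 2 * (1 / (1 - s))) <= expR (s * T / 2 - 1 / 3) / 2.
  have e1 : expR (-1) <= 1 / 2 :> R.
    rewrite expRN div1r lef_pV2 ?posrE ?expR_gt0//.
    by rewrite (le_trans _ (expR_ge1Dx _)).
  apply: (@le_trans _ _ (expR (s * T / 2 - 1 / 3) * expR (-1))); last first.
    by apply: ler_wpM2l; rewrite ?expR_ge0//; lra.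
  rewrite -!expRD ler_expR.
  have s1 : 0 < 1 - s by lra.
  have -> : (p%:R * s + T) / 2 * (1 / (1 - s)) =
     T / 2 + s * T / 2 + (p%:R * s + s ^+ 2 * T) / 2 * (1 / (1 - s)).
    by field; rewrite gt_eqF.
  have : (p%:R * s + s ^+ 2 * T) / 2 * (1 / (1 - s)) <= g ^+ 2 / 4 * (4 / 3).
    apply: ler_pM.
    - by rewrite divr_ge0// addr_ge0 ?mulr_ge0 ?sqr_ge0// ltW.
    - by rewrite divr_ge0// ltW.
    - by lra.
    - by rewrite ler_pdivrMr//; lra.
  lra.
have : k * wmean tau m.+1 (fun x => expR (1 / 2 * cdot (y + x) (y + x))) <=
   expR (s * T / 2 - 1 / 3) / 2.
  by apply: le_trans H4; rewrite ler_wpM2l// expR_ge0.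
lra.
Qed.

Lemma wmean_sqr_le s m : 0 < s -> s <= 1 / 4 ->
  wmean (Num.sqrt (s / m.+1%:R)) m.+1 (fun x : 'cV[R]_p => expR (cdot x x / 2)) <=
  expR (2 / 3 * p%:R * s).
Proof.
move=> s0 s4; set tau := Num.sqrt _.
have mtau : m.+1%:R * tau ^+ 2 = s.
  rewrite sqr_sqrtr ?divr_ge0// 1?ltW//; field.
  by rewrite gt_eqF// ltr0n.
have := @wmean_quad R p tau m.+1 1 0 ler01.
rewrite mtau mul1r cdot0l addr0 => H.
rewrite (@eq_wmean _ _ _ _ _ (fun x => expR (1 / 2 * cdot (0 + x) (0 + x)))).
  apply: le_trans (H _) _; first lra.
  rewrite ler_expR.
  have s1 : 0 < 1 - s by lra.
  have ps : 0 <= p%:R * s / 2 by rewrite divr_ge0// mulr_ge0// ltW.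
  have : 1 / (1 - s) <= 4 / 3 by rewrite ler_pdivrMr//; lra.
  by move=> /(ler_wpM2l ps); lra.
by move=> x; rewrite add0r mulrC mul1r.
Qed.

End trunc.

Section tail.
Context {R : realType} d {Omega : measurableType d} (P : probability Omega R).
Context {p : nat} (Y : Omega -> 'cV[R]_p) (g : R).
Hypothesis mY : forall j, measurable_fun [set: Omega] (fun w => Y w j ord0).
Hypothesis Yexp : forall x : 'cV[R]_p, cdot x x <= g ^+ 2 ->
  (\int[P]_w (expR (cdot x (Y w)))%:E <= (expR (cdot x x / 2))%:E)%E.

Lemma measurable_cdot (x : 'cV[R]_p) : measurable_fun [set: Omega] (fun w => cdot x (Y w)).
Proof.
by apply: measurable_sum => j; apply: measurable_funM.
Qed.

Lemma measurable_cdot_sqr : measurable_fun [set: Omega] (fun w => cdot (Y w) (Y w)).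
Proof.
by apply: measurable_sum => j; apply: measurable_funM.
Qed.

Lemma measurable_ge_set (f : Omega -> R) (T : R) : measurable_fun [set: Omega] f ->
  measurable [set w | T <= f w].
Proof.
move=> mf; have := mf measurableT `[T, +oo[%classic (measurable_itv _).
by rewrite setTI; congr measurable; apply/seteqP; split => w/=; rewrite in_itv/= andbT.
Qed.

(** The exponential weight is symmetrised because [cosh] increases along rays from the origin: a
    lower bound on the sphere [|y|^2 = T] then extends to [|y|^2 >= T]. *)
Let cosh_trunc (x y : 'cV[R]_p) : R := (cdot x x <= g ^+ 2)%R%:R *
  ((expR (cdot x y) + expR (- cdot x y)) / 2).

Let cosh_trunc_ge0 x y : 0 <= cosh_trunc x y.
Proof. by rewrite mulr_ge0// divr_ge0// addr_ge0// expR_ge0. Qed.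

Let measurable_cosh_trunc x : measurable_fun [set: Omega] (fun w => cosh_trunc x (Y w)).
Proof.
apply: measurable_funM => //; apply: measurable_funM => //.
apply: measurable_funD; apply: measurableT_comp => //.
  exact: measurable_cdot.
by apply: measurableT_comp => //; exact: measurable_cdot.
Qed.

Let integral_cosh_trunc_le x :
  (\int[P]_w (cosh_trunc x (Y w))%:E <= (expR (cdot x x / 2))%:E)%E.
Proof.
rewrite /cosh_trunc; case: (leP (cdot x x) (g ^+ 2)) => [xg|_]; last first.
  under eq_integral do rewrite /= mulr0n mul0r.
  by rewrite integral0 lee_fin expR_ge0.
have mx := measurable_cdot x.
under eq_integral do rewrite /= mulr1n mul1r mulrC EFinM.
rewrite ge0_integralZl//; last first.
- apply/measurable_EFinP; apply: measurable_funD; apply: measurableT_comp => //.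
  exact: measurableT_comp.
under eq_integral do rewrite EFinD.
rewrite ge0_integralD//; last 2 first.
- by apply/measurable_EFinP; apply: measurableT_comp.
- by apply/measurable_EFinP; do 2 apply: measurableT_comp => //.
have := Yexp xg; have := @Yexp (- x).
rewrite cdotNl cdotNr opprK => /(_ xg) h1 h2.
under [X in (_ * (_ + X))%E]eq_integral do rewrite -cdotNl.
apply: (@le_trans _ _ ((2^-1)%:E * ((expR (cdot x x / 2))%:E + (expR (cdot x x / 2))%:E))%E).
  by apply: lee_wpmul2l; [rewrite lee_fin|exact: leeD].
by rewrite -EFinD -EFinM lee_fin; lra.
Qed.

(** Markov's inequality for [Phi], the walk average of the truncated weights. It is at least [W] on
    the event, and its integral is bounded by exchanging integral and finite average and then
    applying [wmean_sqr_le]. *)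
Lemma subgaussian_tail (s T : R) : 0 < s -> s <= 1 / 4 -> 0 <= T ->
  p%:R * s + s ^+ 2 * T <= g ^+ 2 / 2 -> 8 <= g ^+ 2 ->
  (P [set w | (T <= cdot (Y w) (Y w))%R] <=
   (2 * expR (2 / 3 * p%:R * s - s * T / 2 + 1 / 3))%:E)%E.
Proof.
move=> s0 s4 T0 sT g8.
(* Enough steps to bring the fourth-order loss of [wmean_exp_ge] below [1 / 3]. *)
have [m mT] : exists m, s ^+ 2 * T ^+ 2 / (8 * m.+1%:R) <= 1 / 3.
  exists (Num.truncn (s ^+ 2 * T ^+ 2)).
  have := truncnS_gt (s ^+ 2 * T ^+ 2).
  set N := _.+1%:R => TN.
  have N0 : 0 < N by rewrite ltr0n.
  by rewrite ler_pdivrMr ?mulr_gt0//; lra.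
set tau := Num.sqrt (s / m.+1%:R).
pose W := expR (s * T / 2 - 1 / 3) / 2.
have W0 : 0 < W by rewrite divr_gt0// expR_gt0.
pose Phi w := wmean tau m.+1 (cosh_trunc ^~ (Y w)).
set A := [set w | _].
have mA : measurable A.
  exact: measurable_ge_set measurable_cdot_sqr.
have PhiW w : A w -> W <= Phi w.
  rewrite /A/= => TY; set T' := cdot _ _ in TY.
  (* The factor [k] moves [Y w] radially onto the sphere of squared radius [T]; the case [T = 0] is
     separate since [T'] may then vanish. *)
  pose k := if T == 0 then 0 else Num.sqrt (T / T').
  have k01 : 0 <= k <= 1.
    rewrite /k; case: ifP => [_|/negbT T1]; first by rewrite lexx ler01.
    have {}T1 : 0 < T by rewrite lt_def T1.
    have T'0 : 0 < T' by exact: lt_le_trans TY.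
    rewrite sqrtr_ge0/= -sqrtr1 ler_wsqrtr// ler_pdivrMr//.
    by rewrite mul1r.
  have kT : cdot (k *: Y w) (k *: Y w) = T.
    rewrite cdotZl cdotZr -/T' mulrA -expr2 /k; case: ifP => [/eqP->|/negbT T1].
      by rewrite expr0n mul0r.
    have {}T1 : 0 < T by rewrite lt_def T1.
    have T'0 : 0 < T' by exact: lt_le_trans TY.
    by rewrite sqr_sqrtr ?divr_ge0 ?(ltW T'0)//; field; rewrite gt_eqF.
  have h1 := wmean_trunc_ge s0 s4 kT sT g8 mT.
  have kT' : cdot (- (k *: Y w)) (- (k *: Y w)) = T by rewrite cdotNl cdotNr opprK.
  have h2 := wmean_trunc_ge s0 s4 kT' sT g8 mT.
  rewrite -/tau -/W in h1 h2.
  (* The bounds at [k Y] and [- k Y] are averaged, which produces [cosh (k x . Y)], and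
     [cosh_scale_le] removes [k]. *)
  have : 2^-1 * (wmean tau m.+1 (fun x =>
        (cdot x x <= g ^+ 2)%R%:R * expR (cdot x (k *: Y w))) +
      wmean tau m.+1 (fun x =>
        (cdot x x <= g ^+ 2)%R%:R * expR (cdot x (- (k *: Y w))))) <= Phi w.
    rewrite -wmeanD -wmeanZ; apply: wmean_le => x.
    rewrite /cosh_trunc -mulrDr mulrCA ler_wpM2l// [leRHS]mulrC ler_wpM2l// cdotNr cdotZr.
    exact: cosh_scale_le.
  lra.
have PhiU : (\int[P]_w (Phi w)%:E <= (expR (2 / 3 * p%:R * s))%:E)%E.
  apply: le_trans (_ : (_ <= (wmean tau m.+1 (fun x => expR (cdot x x / 2)))%:E)%E) _; last first.
    by rewrite lee_fin; exact: wmean_sqr_le.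
  rewrite /Phi /wmean; under eq_integral do rewrite EFinM -sumEFin.
  have c0 : 0 <= (2 ^+ p) ^- m.+1 :> R by rewrite invr_ge0 !exprn_ge0.
  rewrite ge0_integralZl//; last 2 first.
  - apply: emeasurable_sum => x; exact/measurable_EFinP.
  - by move=> w _; apply: sume_ge0 => x _; rewrite lee_fin.
  rewrite EFinM; apply: lee_wpmul2l; first by rewrite lee_fin.
  rewrite ge0_integral_sum//; last 2 first.
  - by move=> x; exact/measurable_EFinP.
  - by move=> x w _; rewrite lee_fin.
  by rewrite -sumEFin; apply: lee_sum => x _; exact: integral_cosh_trunc_le.
have : (W%:E * P A <= (expR (2 / 3 * p%:R * s))%:E)%E.
  apply: le_trans PhiU.
  have -> : (W%:E * P A = \int[P]_w (W * \1_A w)%:E)%E.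
    under eq_integral do rewrite EFinM.
    rewrite ge0_integralZl//; last 2 first.
    - exact/measurable_EFinP.
    - by rewrite lee_fin ltW.
    by rewrite integral_indic// setIT.
  apply: ge0_le_integral => //.
  - by move=> w _; rewrite lee_fin mulr_ge0// ltW.
  - by apply/measurable_EFinP; exact: measurable_funM.
  - apply/measurable_EFinP; apply: measurable_funM => //.
    by apply: measurable_sum => x.
  - move=> w _; rewrite lee_fin indicE.
    case: (boolP (w \in A)) => [/set_mem /PhiW|_]; first by rewrite mulr1.
    rewrite mulr0 /Phi /wmean mulr_ge0// ?invr_ge0 ?exprn_ge0//.
    exact: sumr_ge0.
have -> : (2 * expR (2 / 3 * p%:R * s - s * T / 2 + 1 / 3))%:E =
    ((expR (2 / 3 * p%:R * s) / W)%:E)%E.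
  congr EFin; rewrite /W.
  have -> : 2 / 3 * p%:R * s - s * T / 2 + 1 / 3 = 2 / 3 * p%:R * s - (s * T / 2 - 1 / 3) by ring.
  rewrite expRB; field; by rewrite gt_eqF ?expR_gt0.
rewrite -[P A]fineK ?fin_num_measure// -EFinM !lee_fin ler_pdivlMr//.
by rewrite mulrC.
Qed.

(** Three regimes. For [g^2 <= 8] the bound is trivial. For [p] below [3 g^2 / 4] the variance
    [s = 1 / 4] is admissible and yields the [e^-z] term. For larger [p] the variance must shrink
    like [g^2 / p], and only the [exp(- g^2 / 4)] term is obtained. *)
Lemma subgaussian_norm_tail (z : R) : 0 < g -> 0 < z -> z <= g ^+ 2 / 4 -> (0 < p)%N ->
  (P [set w | (2 * (Num.sqrt p%:R + Num.sqrt (2 * z)) <= enorm (Y w))%R] <=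
   (2 * expR (- z) + (84%:R / 10%:R) * expR (- (g ^+ 2 / 4)))%:E)%E.
Proof.
move=> g0 z0 zg p0.
set A := [set w | _].
(* The squared threshold is [4 p + 8 z] plus a nonnegative cross term, which is dropped. *)
have AT T : T <= 4 * p%:R + 8 * z -> A `<=` [set w | T <= cdot (Y w) (Y w)].
  move=> TT w; rewrite /A/= => Aw; apply: le_trans TT _; rewrite -enorm_sqr.
  set a := Num.sqrt _ in Aw; set b := Num.sqrt _ in Aw.
  have a2 : a ^+ 2 = p%:R by rewrite sqr_sqrtr.
  have b2 : b ^+ 2 = 2 * z by rewrite sqr_sqrtr// mulr_ge0// ltW.
  have a0 : 0 <= a by exact: sqrtr_ge0.
  have b0 : 0 <= b by exact: sqrtr_ge0.
  apply: (@le_trans _ _ ((2 * (a + b)) ^+ 2)).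
    have := mulr_ge0 a0 b0.
    rewrite -a2 (_ : 8 * z = 4 * b ^+ 2); last by rewrite b2; ring.
    lra.
  by rewrite ler_sqr// nnegrE ?enorm_ge0// mulr_ge0// addr_ge0.
have mA : measurable A.
  apply: measurable_ge_set; apply: measurableT_comp measurable_cdot_sqr.
  exact: continuous_measurable_fun (@sqrt_continuous _).
have mT T : measurable [set w | T <= cdot (Y w) (Y w)].
  exact: measurable_ge_set measurable_cdot_sqr.
have e0 (x : R) : 0 < expR x := expR_gt0 x.
have e3 : expR 1 <= 3 :> R.
  (* From [exp(- 1/6) >= 5/6]; the sixth power [(6/5)^6] is just below 3. *)
  have e6 : expR (1 / 6) <= 6 / 5 :> R.
    rewrite -[leLHS]invrK -[leRHS]invrK lef_pV2 ?posrE ?invr_gt0//.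
    by rewrite -expRN; apply: le_trans (expR_ge1Dx _); lra.
  rewrite (_ : 1 = 6 * (1 / 6)); last by field.
  rewrite expRM_natl (@le_trans _ _ ((6 / 5) ^+ 6))//; last lra.
  by rewrite lerXn2r// nnegrE ltW.
have [g8|/ltW g8] := leP (g ^+ 2) 8.
  (* The right-hand side exceeds 1. *)
  apply: le_trans (probability_le1 P mA) _.
  have h2 : expR (- (g ^+ 2 / 4)) <= expR (- z) by rewrite ler_expR; lra.
  (* Both exponentials are at least [e^-2 >= 1 / 9], and [2 + 8.4 > 9]. *)
  have : 1 / 9 <= expR (- (g ^+ 2 / 4)).
    apply: (@le_trans _ _ (expR (- 2))); last by rewrite ler_expR; lra.
    rewrite expRN div1r lef_pV2 ?posrE//.
    have -> : expR 2 = expR 1 ^+ 2 :> R by rewrite -expRM_natl mulr1.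
    by rewrite (_ : 9 = 3 ^+ 2); [rewrite lerXn2r ?nnegrE// ltW|ring].
  rewrite lee_fin; lra.
have [pg|/ltW pg] := leP p%:R (3 / 4 * g ^+ 2).
  (* With [s = 1 / 4] the admissibility condition reads [p / 2 + z / 2 <= g^2 / 2], which follows
     from [p < 3 g^2 / 4] and [z <= g^2 / 4]. The exponent becomes [- z - (p - 1) / 3]. *)
  pose T := 4 * p%:R + 8 * z.
  apply: le_trans (le_measure P _ _ (AT T _)) _; rewrite ?inE//.
  have T0 : 0 <= T by rewrite /T addr_ge0 ?mulr_ge0// ltW.
  apply: le_trans (@subgaussian_tail (1 / 4) T _ _ T0 _ g8) _; rewrite /T; [lra|lra|lra|].
  rewrite lee_fin.
  have : expR (2 / 3 * p%:R * (1 / 4) - 1 / 4 * T / 2 + 1 / 3) <= expR (- z).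
    have p1 : 1 <= p%:R :> R by rewrite ler1n.
    by rewrite ler_expR /T; lra.
  have := e0 (- (g ^+ 2 / 4)).
  rewrite /T; lra.
have p1 : 0 < p%:R :> R by rewrite ltr0n.
(* Chosen so that with [T = 4 p] the exponent [- (4 / 3) p s] is exactly [- g^2 / 4]; [s <= 1 / 4]
   is the case assumption on [p]. *)
pose s := 3 / 16 * g ^+ 2 / p%:R.
have ps : p%:R * s = 3 / 16 * g ^+ 2 by rewrite /s; field; rewrite gt_eqF.
have g2 : 0 < g ^+ 2 by rewrite exprn_gt0.
have s0 : 0 < s by rewrite divr_gt0// mulr_gt0//.
have s4 : s <= 1 / 4 by rewrite ler_pdivrMr//; lra.
pose T := 4 * p%:R : R.
apply: le_trans (le_measure P _ _ (AT T _)) _; rewrite ?inE//.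
  by rewrite /T; lra.
have T0 : 0 <= T by rewrite mulr_ge0.
apply: le_trans (@subgaussian_tail s T s0 s4 T0 _ g8) _.
  rewrite /T (_ : p%:R * s + s ^+ 2 * (4 * p%:R) = p%:R * s + 4 * s * (p%:R * s)); last by ring.
  rewrite ps.
  have : s * (3 / 16 * g ^+ 2) <= 1 / 4 * (3 / 16 * g ^+ 2) by rewrite ler_wpM2r// mulr_ge0// ltW.
  lra.
rewrite lee_fin (_ : 2 / 3 * p%:R * s - s * T / 2 + 1 / 3 = - (g ^+ 2 / 4) + 1 / 3); last first.
  rewrite /T (_ : 2 / 3 * p%:R * s - s * (4 * p%:R) / 2 = - (4 / 3) * (p%:R * s)); last by field.
  by rewrite ps; field.
rewrite expRD.
(* The resulting constant is [2 * 3 = 6], below 8.4. *)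
have e13 : expR (1 / 3) <= 3 :> R.
  by apply: le_trans e3; rewrite ler_expR; lra.
have := ler_wpM2l (ltW (e0 (- (g ^+ 2 / 4)))) e13.
have := e0 (- z); have := e0 (- (g ^+ 2 / 4)).
lra.
Qed.

End tail.

(** * Integration over the cube *)

Section param_integral.
Context {R : realType} {dT : measure_display} {T : measurableType dT}.

(** The positive and negative parts are treated separately by Tonelli, so measurability is obtained
    without integrability. *)
Lemma measurable_param_Rintegral (F : T * R -> R) : measurable_fun setT F ->
  measurable_fun setT (fun x => Rintegral (@lebesgue_measure R) setT (fun t => F (x, t))).
Proof.
move=> mF; apply: (@measurableT_comp _ _ _ _ _ _ fine) => //.
under eq_fun do rewrite integralE.
have mE : measurable_fun setT (fun z => (F z)%:E) by exact/measurable_EFinP.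
apply: emeasurable_funB.
- have := measurable_fun_fubini_tonelli_F (m2 := @lebesgue_measure R) _
    (measurable_funepos mE) (funepos_ge0 _).
  by congr measurable_fun; apply/funext => x; apply: eq_integral => t _; rewrite !funeposE.
- have := measurable_fun_fubini_tonelli_F (m2 := @lebesgue_measure R) _
    (measurable_funeneg mE) (funeneg_ge0 _).
  by congr measurable_fun; apply/funext => x; apply: eq_integral => t _; rewrite !funenegE.
Qed.

End param_integral.

Section leb_Rint.
Context {R : realType}.

(** The parameter space is arbitrary so that the induction on [d] can move the first coordinate into
    the parameter. *)
Lemma measurable_leb_Rint d (dT : measure_display) (T : measurableType dT)
    (g : T * d.-tuple R -> R) : measurable_fun setT g ->
  measurable_fun setT (fun x => leb_Rint (fun y => g (x, y))).
Proof.
elim: d dT T g => [|d IH] dT T g mg /=.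
  by apply: (measurableT_comp mg); exact: measurable_fun_pair.
apply: (measurable_param_Rintegral
  (F := fun z => leb_Rint (fun y => g (z.1, [tuple of z.2 :: y])))).
apply: (IH _ _ (fun z => g (z.1.1, [tuple of z.1.2 :: z.2]))).
apply: (measurableT_comp mg); apply: measurable_fun_pair.
  exact: measurableT_comp.
apply: measurable_cons => //; exact: measurableT_comp.
Qed.


(** This domination is inherited by sections: fixing the first coordinate [x] only multiplies [M] by
    the indicator of [[-1, 1]] at [x]. Every level of the iterated integral is thus integrable. *)
Definition cube_bounded d (M : R) (g : d.-tuple R -> R) :=
  measurable_fun setT g /\ forall t, `|g t| <= M * \1_(@cube R d) t.

Lemma cube_cons d (x : R) (y : d.-tuple R) :
  \1_(@cube R d.+1) [tuple of x :: y] = \1_(`[-1, 1]%classic) x * \1_(@cube R d) y :> R.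
Proof.
rewrite !indicE -natrM mulnb; congr ((_ : bool)%:R).
apply/idP/andP => [/set_mem h|[/set_mem/= xI /set_mem yc]].
  split; apply/mem_set.
    by have := h ord0; rewrite tnth0 /= in_itv.
  by move=> k; have := h (lift ord0 k); rewrite tnthS.
apply/mem_set => k; have [->|k0] := eqVneq k ord0.
  by rewrite tnth0; rewrite in_itv in xI.
case: (unliftP ord0 k) => [j kj|e]; last by rewrite e eqxx in k0.
rewrite kj tnthS; exact: yc.
Qed.

Lemma cube_bounded_cons d M (g : d.+1.-tuple R -> R) (x : R) : cube_bounded M g ->
  cube_bounded (M * \1_(`[-1, 1]%classic) x) (fun y : d.-tuple R => g [tuple of x :: y]).
Proof.
move=> [mg gM]; split; first by apply: (measurableT_comp mg); exact: measurable_cons.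
by move=> t; rewrite -mulrA -cube_cons.
Qed.

Lemma measurable_leb_Rint_cons d M (g : d.+1.-tuple R -> R) : cube_bounded M g ->
  measurable_fun setT (fun x => leb_Rint (fun y : d.-tuple R => g [tuple of x :: y])).
Proof.
move=> [mg gM]; apply: (measurable_leb_Rint (g := fun z => g [tuple of z.1 :: z.2])).
by apply: (measurableT_comp mg); exact: measurable_cons.
Qed.

Lemma integrable_itv_bounded (M : R) (f : R -> R) : measurable_fun setT f ->
  (forall x, `|f x| <= M * \1_(`[-1, 1]%classic) x) ->
  (@lebesgue_measure R).-integrable setT (EFin \o f).
Proof.
move=> mf fM.
have gi : (@lebesgue_measure R).-integrable setT (fun x => (M * \1_(`[-1, 1]%classic) x)%:E).
  have := integrableZl measurableT M (@integrable_indic_itv R (-1) 1 true false).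
  by apply: eq_integrable => // x _ /=; rewrite EFinM.
apply: le_integrable gi => //; first exact/measurable_EFinP.
by move=> x _ /=; rewrite lee_fin; apply: le_trans (fM x) _; exact: ler_norm.
Qed.

Lemma Rintegral_itv_bounded (M : R) (f : R -> R) : measurable_fun setT f ->
  (forall x, `|f x| <= M * \1_(`[-1, 1]%classic) x) ->
  `|Rintegral (@lebesgue_measure R) setT f| <= M * 2.
Proof.
move=> mf fM; have fi := integrable_itv_bounded mf fM.
apply: le_trans (le_normr_Rintegral measurableT fi) _.
have ii := @integrable_indic_itv R (-1) 1 true false.
apply: (@le_trans _ _ (Rintegral (@lebesgue_measure R) setT
    (fun x => M * \1_(`[-1, 1]%classic) x))).
  apply: le_Rintegral => //.
  - exact: (integrable_norm fi).
  - have := integrableZl measurableT M ii.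
    by apply: eq_integrable => // x _ /=; rewrite EFinM.
have leb2 : fine (lebesgue_measure (`[-1, 1]%classic : set R)) = 2.
  by rewrite lebesgue_measure_itv/= lte_fin ifT ?gtrN//= opprK.
rewrite RintegralZl// /Rintegral integral_indic// setIT.
by rewrite (_ : fine _ = 2).
Qed.

Lemma leb_Rint_bound d M (g : d.-tuple R -> R) : cube_bounded M g ->
  `|leb_Rint g| <= M * 2 ^+ d.
Proof.
elim: d M g => [|d IH] M g gM /=.
  case: gM => _ /(_ [tuple]); rewrite expr0 indicE.
  by case: (boolP (_ \in _)) => // /negP[]; apply/mem_set => -[].
rewrite exprSr mulrA; apply: Rintegral_itv_bounded.
  exact: measurable_leb_Rint_cons gM.
by move=> x; rewrite mulrAC; apply: IH; exact: cube_bounded_cons.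
Qed.

Lemma leb_Rint_linear d M N a (f g : d.-tuple R -> R) :
  cube_bounded M f -> cube_bounded N g ->
  leb_Rint (fun t => a * f t + g t) = a * leb_Rint f + leb_Rint g.
Proof.
elim: d M N f g => [//|d IH] M N f g fM gN /=.
under eq_Rintegral do rewrite (IH _ _ _ _ (cube_bounded_cons _ fM) (cube_bounded_cons _ gN)).
have mf := measurable_leb_Rint_cons fM.
have mg := measurable_leb_Rint_cons gN.
have fi : (@lebesgue_measure R).-integrable setT
    (EFin \o (fun x => leb_Rint (fun y : d.-tuple R => f [tuple of x :: y]))).
  apply: (@integrable_itv_bounded (M * 2 ^+ d)) => // x.
  by rewrite mulrAC; exact: leb_Rint_bound (cube_bounded_cons _ fM).
have gi : (@lebesgue_measure R).-integrable setT
    (EFin \o (fun x => leb_Rint (fun y : d.-tuple R => g [tuple of x :: y]))).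
  apply: (@integrable_itv_bounded (N * 2 ^+ d)) => // x.
  by rewrite mulrAC; exact: leb_Rint_bound (cube_bounded_cons _ gN).
rewrite RintegralD// ?RintegralZl//.
have := integrableZl measurableT a fi.
by apply: eq_integrable => // x _ /=; rewrite EFinM.
Qed.

Lemma leb_Rint_ge0 d (g : d.-tuple R -> R) : (forall t, 0 <= g t) -> 0 <= leb_Rint g.
Proof.
elim: d g => [|d IH] g g0 //=.
by apply: Rintegral_ge0 => x _; exact: IH.
Qed.

Lemma measurable_cube d : measurable (@cube R d).
Proof.
have -> : @cube R d = \bigcap_(k in [set: 'I_d]) ((fun t => tnth t k) @^-1` `[-1, 1]%classic).
  apply/seteqP; split => [t h k _ /=|t h k]; first by rewrite in_itv; exact: h.
  by have := h k I; rewrite /= in_itv.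
apply: fin_bigcap_measurable => [|k _]; first exact: finite_finset.
rewrite -[X in measurable X]setTI.
exact: measurable_tnth.
Qed.

Definition bounded_measurable dT (T : measurableType dT) (g : T -> R) :=
  measurable_fun setT g /\ exists M, forall t, `|g t| <= M.

Definition cube_int d (g : d.-tuple R -> R) := leb_Rint (fun t => \1_(@cube R d) t * g t).

Lemma cube_bounded_indic d M (g : d.-tuple R -> R) :
  measurable_fun setT g -> (forall t, `|g t| <= M) ->
  cube_bounded M (fun t => \1_(@cube R d) t * g t).
Proof.
move=> mg gM; split.
  by apply: measurable_funM => //; apply: measurable_indic; exact: measurable_cube.
by move=> t; rewrite normrM mulrC (ger0_norm (_ : 0 <= \1__ t)) ?ler_wpM2r.
Qed.

Lemma cube_int_bound d M (g : d.-tuple R -> R) :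
  measurable_fun setT g -> (forall t, `|g t| <= M) -> `|cube_int g| <= M * 2 ^+ d.
Proof. by move=> mg gM; apply: leb_Rint_bound; exact: cube_bounded_indic. Qed.

Lemma cube_int_linear d a (f g : d.-tuple R -> R) :
  bounded_measurable f -> bounded_measurable g ->
  cube_int (fun t => a * f t + g t) = a * cube_int f + cube_int g.
Proof.
move=> [mf [M fM]] [mg [N gN]].
rewrite /cube_int -(leb_Rint_linear _ (cube_bounded_indic mf fM) (cube_bounded_indic mg gN)).
by congr leb_Rint; apply/funext => t; ring.
Qed.

Lemma cube_int_ge0 d (g : d.-tuple R -> R) : (forall t, 0 <= g t) -> 0 <= cube_int g.
Proof. by move=> g0; apply: leb_Rint_ge0 => t; rewrite mulr_ge0. Qed.

End leb_Rint.

(** * Differentiation under the integral over the cube *)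

Section quad.
Context {R : realType}.

(** A quadratic remainder makes the error of the difference quotient at most [C |u|]. Such a
    remainder passes through the iterated integral by linearity and the uniform bound. *)
Lemma is_derive_quad (f : R -> R) (x l C : R) : 0 <= C ->
  (forall u, `|u| <= 1 -> `|f (x + u) - f x - u * l| <= C * u ^+ 2) ->
  is_derive x 1 f l.
Proof.
move=> C0 fC.
have cv : h^-1 *: (f (h *: 1 + x) - f x) @[h --> 0^'] --> l.
  apply/cvgrPdist_le => e e0; near=> h.
  have h0 : h != 0 by near: h; exact: nbhs_dnbhs_neq.
  have h1 : `|h| <= 1 by near: h; exact: dnbhs0_le.
  (* [C + 1] rather than [C], since [C] may be 0. *)
  have hC : `|h| <= e / (C + 1).
    by near: h; apply: dnbhs0_le; rewrite divr_gt0// ltr_wpDl.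
  have hp : 0 < `|h| by rewrite normr_gt0.
  rewrite (_ : h *: 1 + x = x + h); last by rewrite /GRing.scale/= mulr1 addrC.
  rewrite /GRing.scale/= (_ : l - _ = - (h^-1 * (f (x + h) - f x - h * l))); last by field.
  rewrite normrN normrM normfV mulrC ler_pdivrMr//.
  apply: le_trans (fC _ h1) _; rewrite -(real_normK (num_real h)) expr2 mulrA ler_pM2r//.
  move: hC; rewrite ler_pdivlMr ?ltr_wpDl// => hC.
  apply: le_trans hC; rewrite mulrC; apply: ler_wpM2l => //.
  by rewrite lerDl.
apply: DeriveDef; first by apply: cvgP cv.
exact: cvg_lim cv.
Unshelve. all: by end_near. Qed.

(** From [e^x (1 - x) <= 1] the remainder is at most [x (e^x - 1)]; the same inequality gives
    [e^x - 1 <= x e^x] for [x >= 0], while [e^x - 1 >= x] serves for [x < 0]. *)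
Lemma expR_quad_le (x : R) : `|expR x - 1 - x| <= x ^+ 2 * expR `|x|.
Proof.
have h1 := expR_ge1Dx x; have h2 := expR_ge1Dx (- x).
rewrite ger0_norm; last by rewrite -addrA -opprD subr_ge0.
have e0 := expR_gt0 x; have xx := expRxMexpNx_1 x.
have h3 : expR x * (1 - x) <= 1 by rewrite -[leRHS]xx ler_wpM2l// ltW.
apply: (@le_trans _ _ (x * (expR x - 1))); first by rewrite mulrBr mulr1; lra.
have [x0|x0] := leP 0 x.
  rewrite ger0_norm// expr2 -mulrA ler_wpM2l//; lra.
apply: (@le_trans _ _ (x ^+ 2)).
  rewrite expr2 ler_wnM2l//; [exact: ltW|lra].
by rewrite ler_peMr ?sqr_ge0// -expR0 ler_expR.
Qed.

End quad.

Section bounded_measurable.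
Context {R : realType} dT (T : measurableType dT).
Implicit Types f g : T -> R.

Lemma bounded_measurable_cst (a : R) : bounded_measurable (fun _ : T => a).
Proof. by split; [exact: measurable_cst|exists `|a|]. Qed.

Lemma bounded_measurableM f g : bounded_measurable f -> bounded_measurable g ->
  bounded_measurable (fun t => f t * g t).
Proof.
move=> [mf [M fM]] [mg [N gN]]; split; first exact: measurable_funM.
by exists (M * N) => t; rewrite normrM ler_pM.
Qed.

Lemma bounded_measurableD f g : bounded_measurable f -> bounded_measurable g ->
  bounded_measurable (fun t => f t + g t).
Proof.
move=> [mf [M fM]] [mg [N gN]]; split; first exact: measurable_funD.
by exists (M + N) => t; rewrite (le_trans (ler_normD _ _))// lerD.
Qed.

Lemma bounded_measurable_exp f : bounded_measurable f ->
  bounded_measurable (fun t => expR (f t)).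
Proof.
move=> [mf [M fM]]; split; first exact: measurableT_comp.
exists (expR M) => t; rewrite ger0_norm ?expR_ge0// ler_expR.
exact: le_trans (ler_norm _) _.
Qed.

Lemma bounded_measurable_sum (I : Type) (r : seq I) (f : I -> T -> R) :
  (forall i, bounded_measurable (f i)) ->
  bounded_measurable (fun t => \sum_(i <- r) f i t).
Proof.
move=> bf; elim: r => [|i r IH].
  by under eq_fun do rewrite big_nil; exact: bounded_measurable_cst.
by under eq_fun do rewrite big_cons; exact: bounded_measurableD.
Qed.

End bounded_measurable.

Section cube_int.
Context {R : realType} {d : nat}.

Lemma cube_int_cst0 : cube_int (fun _ : d.-tuple R => 0) = 0.
Proof.
apply/eqP; rewrite -normr_eq0 -normr_le0 -[leRHS](mul0r (2 ^+ d)).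
by rewrite normr_id; apply: cube_int_bound => // t; rewrite normr0.
Qed.

Lemma cube_int_sum (I : Type) (r : seq I) (a : I -> R) (f : I -> d.-tuple R -> R) :
  (forall i, bounded_measurable (f i)) ->
  cube_int (fun t => \sum_(i <- r) a i * f i t) = \sum_(i <- r) a i * cube_int (f i).
Proof.
move=> bf; elim: r => [|i r IH].
  by under eq_fun do rewrite big_nil; rewrite big_nil cube_int_cst0.
under eq_fun do rewrite big_cons; rewrite big_cons cube_int_linear ?IH//.
apply: bounded_measurable_sum => j; apply: bounded_measurableM => //.
exact: bounded_measurable_cst.
Qed.

(** The remainder integrand is [k exp(c + s b) (exp(u b) - 1 - u b)], bounded by [M B^2 e^B u^2]
    uniformly on the cube. *)
Lemma is_derive_cube_int_exp (k b c : d.-tuple R -> R) (s : R) :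
  bounded_measurable k -> bounded_measurable b -> bounded_measurable c ->
  is_derive s 1 (fun s => cube_int (fun t => k t * expR (c t + s * b t)))
    (cube_int (fun t => k t * b t * expR (c t + s * b t))).
Proof.
move=> bk bb bc.
have be u : bounded_measurable (fun t => expR (c t + u * b t)).
  apply: bounded_measurable_exp; apply: bounded_measurableD => //.
  by apply: bounded_measurableM => //; exact: bounded_measurable_cst.
have bke := bounded_measurableM bk (be s).
have [mke [M keM]] := bke; have [mb [B bB]] := bb.
(* Evaluating the bounds at some point shows that [M] and [B] are nonnegative. *)
have pt : d.-tuple R := [tuple 0 | i < d].
have M0 : 0 <= M by exact: le_trans (keM pt).
have B0 : 0 <= B by exact: le_trans (bB pt).
apply: (@is_derive_quad _ _ _ _ (M * (B ^+ 2 * expR B) * 2 ^+ d)).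
  by rewrite !mulr_ge0 ?exprn_ge0// expR_ge0.
move=> u u1.
have b1 : bounded_measurable (fun t => k t * b t * expR (c t + s * b t)).
  by apply: bounded_measurableM => //; exact: bounded_measurableM.
have b2 : bounded_measurable (fun t => k t * expR (c t + (s + u) * b t)).
  exact: bounded_measurableM.
have b3 : bounded_measurable (fun t => - u * (k t * b t * expR (c t + s * b t)) +
    k t * expR (c t + (s + u) * b t)).
  apply: bounded_measurableD => //; apply: bounded_measurableM => //.
  exact: bounded_measurable_cst.
have -> : cube_int (fun t => k t * expR (c t + (s + u) * b t)) -
  cube_int (fun t => k t * expR (c t + s * b t)) -
  u * cube_int (fun t => k t * b t * expR (c t + s * b t)) =
  cube_int (fun t => -1 * (k t * expR (c t + s * b t)) +
   (- u * (k t * b t * expR (c t + s * b t)) + k t * expR (c t + (s + u) * b t))).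
  by rewrite !cube_int_linear//; ring.
rewrite mulrAC; apply: cube_int_bound.
  by case: (bounded_measurableD (bounded_measurableM (bounded_measurable_cst _ (-1)) bke) b3).
move=> t.
have -> : -1 * (k t * expR (c t + s * b t)) +
   (- u * (k t * b t * expR (c t + s * b t)) + k t * expR (c t + (s + u) * b t)) =
   k t * expR (c t + s * b t) * (expR (u * b t) - 1 - u * b t).
  have -> : expR (c t + (s + u) * b t) = expR (c t + s * b t) * expR (u * b t).
    by rewrite -expRD mulrDl addrA.
  by ring.
rewrite normrM -mulrA; apply: ler_pM => //.
apply: le_trans (expR_quad_le _) _.
have ub : `|u * b t| <= B by rewrite normrM -[leRHS]mul1r ler_pM.
have bB2 : b t ^+ 2 <= B ^+ 2.
  by rewrite -(real_normK (num_real (b t))) ler_sqr ?nnegrE.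
rewrite exprMn [leRHS]mulrC -mulrA ler_wpM2l ?sqr_ge0//.
by rewrite ler_pM ?sqr_ge0 ?expR_ge0// ler_expR.
Qed.

End cube_int.

(** * Score of the local log-likelihood and the deterministic expansion *)

Section posdef.
Context {R : realType} {p : nat}.
Implicit Types (D : 'M[R]_p) (u v : 'cV[R]_p).

Lemma sym_posdef_unit D : sym_posdef D -> D \in unitmx.
Proof.
move=> [DT Dpos]; rewrite -row_free_unit; apply: inj_row_free => v vD.
apply: trmx_inj; rewrite trmx0; apply/eqP/negPn/negP => /Dpos.
by rewrite -[in D *m _]DT -trmx_mul vD trmx0 cdotC cdot0l ltxx.
Qed.

Lemma sym_posdef_cdot D u v : sym_posdef D -> cdot u (D *m v) = cdot (D *m u) v.
Proof. by move=> [DT _]; rewrite cdot_trmx DT. Qed.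

Lemma sym_posdef_cdot_inv D u v : sym_posdef D ->
  cdot u (invmx D *m v) = cdot (invmx D *m u) v.
Proof. by move=> [DT _]; rewrite cdot_trmx trmx_inv DT. Qed.

(** With [x = D^-1 u] and [y = V^-1 u] one has [|x|^2 = <V D^-1 x, y>], and the Loewner bound at
    [D^-1 x] gives [|V D^-1 x| <= a |x|]. *)
Lemma enorm_loewner_le D (V : 'M[R]_p) (a : R) u : sym_posdef D -> sym_posdef V ->
  0 < a -> loewner_le (V *m V) (a ^+ 2 *: (D *m D)) ->
  enorm (invmx D *m u) <= a * enorm (invmx V *m u).
Proof.
move=> Dpd Vpd a0 VD; set x := invmx D *m u; set y := invmx V *m u.
have uE : u = V *m y by rewrite mulKVmx ?sym_posdef_unit.
have [->|x0] := eqVneq x 0.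
  by rewrite {1}/enorm cdot0l sqrtr0 mulr_ge0 ?enorm_ge0// ltW.
have h1 : cdot x x = cdot (V *m (invmx D *m x)) y.
  by rewrite {2}/x sym_posdef_cdot_inv// {1}uE sym_posdef_cdot.
have h2 : enorm (V *m (invmx D *m x)) <= a * enorm x.
  rewrite -ler_sqr ?nnegrE ?enorm_ge0 ?mulr_ge0 ?enorm_ge0 ?(ltW a0)//.
  rewrite exprMn !enorm_sqr; have := VD (invmx D *m x).
  rewrite -scalemxAl cdotZr -!mulmxA (sym_posdef_cdot _ (V *m _) Vpd).
  by rewrite mulKVmx ?sym_posdef_unit// (sym_posdef_cdot _ x Dpd) mulKVmx ?sym_posdef_unit.
have : enorm x ^+ 2 <= enorm x * (a * enorm y).
  rewrite enorm_sqr h1; apply: le_trans (cdot_le_enorm _ _) _.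
  by rewrite mulrCA mulrA ler_wpM2r ?enorm_ge0.
by rewrite expr2 ler_pM2l// enorm_gt0.
Qed.

End posdef.

Section normaliser.
Context {R : realType} {d p : nat}.
Variables (K : d.-tuple R -> R) (Psi : d.-tuple R -> 'cV[R]_p).
Hypothesis bK : bounded_measurable K.
Hypothesis K_ge0 : forall t, 0 <= K t.
Hypothesis bPsi : forall j, bounded_measurable (fun t => Psi t j ord0).
Implicit Types (th u v w : 'cV[R]_p).

(** The convex integral term of the log-likelihood without its factor [n h^d]; [score_int] and
    [hess_int] are its first and second directional derivatives. *)
Definition norm_int th := cube_int (fun t => K t * expR (cdot (Psi t) th)).
Definition score_int th v :=
  cube_int (fun t => K t * cdot (Psi t) v * expR (cdot (Psi t) th)).
Definition hess_int th v w :=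
  cube_int (fun t => K t * cdot (Psi t) w * cdot (Psi t) v * expR (cdot (Psi t) th)).

Lemma bounded_measurable_cdot v : bounded_measurable (fun t => cdot (Psi t) v).
Proof.
apply: bounded_measurable_sum => j; apply: bounded_measurableM => //.
exact: bounded_measurable_cst.
Qed.

Lemma is_derive_norm_int th v (s : R) :
  is_derive s 1 (fun s => norm_int (th + s *: v)) (score_int (th + s *: v) v).
Proof.
have := is_derive_cube_int_exp s bK (bounded_measurable_cdot v) (bounded_measurable_cdot th).
congr (is_derive _ _ _ _); rewrite /norm_int /score_int.
  by apply/funext => r; congr cube_int; apply/funext => t; rewrite cdotDr cdotZr.
by congr cube_int; apply/funext => t; rewrite cdotDr cdotZr.
Qed.

Lemma is_derive_linear_sub_norm_int (sc th v : 'cV[R]_p) (N s : R) :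
  is_derive s 1 (fun s => cdot sc (th + s *: v) - N * norm_int (th + s *: v))
    (cdot sc v - N * score_int (th + s *: v) v).
Proof.
have H := is_derive_norm_int th v s; move: H.
set f := fun s => norm_int _; set l := score_int _ _ => H.
rewrite (_ : (fun s => _) = fun s => cdot sc th + s * cdot sc v - N * f s).
  by apply: is_derive_eq; rewrite /GRing.scale/=; ring.
by apply/funext => r; rewrite cdotDr cdotZr.
Qed.

Lemma is_derive_score_int th v w (s : R) :
  is_derive s 1 (fun s => score_int (th + s *: v) w) (hess_int (th + s *: v) v w).
Proof.
have := is_derive_cube_int_exp s (bounded_measurableM bK (bounded_measurable_cdot w))
  (bounded_measurable_cdot v) (bounded_measurable_cdot th).
congr (is_derive _ _ _ _); rewrite /hess_int /score_int.
  by apply/funext => r; congr cube_int; apply/funext => t; rewrite cdotDr cdotZr.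
by congr cube_int; apply/funext => t; rewrite cdotDr cdotZr.
Qed.

Lemma cdot_delta u j : cdot u (delta_mx j ord0) = u j ord0.
Proof.
rewrite /cdot (bigD1 j)//= mxE !eqxx mulr1 big1 ?addr0// => k kj.
by rewrite mxE (negbTE kj) mulr0.
Qed.

Lemma score_int_sum th v :
  score_int th v = \sum_j v j ord0 * score_int th (delta_mx j ord0).
Proof.
rewrite /score_int -cube_int_sum.
  congr cube_int; apply/funext => t.
  rewrite {1}/cdot mulr_sumr mulr_suml; apply: eq_bigr => j _.
  by rewrite cdot_delta; ring.
move=> j; apply: bounded_measurableM.
  by apply: bounded_measurableM => //; exact: bounded_measurable_cdot.
by apply: bounded_measurable_exp; exact: bounded_measurable_cdot.
Qed.

Lemma hess_int_Dn2 (n : nat) (h : R) th v w :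
  n%:R * h ^+ d * hess_int th v w = cdot w (Dn2 n h K Psi th *m v).
Proof.
pose f j k t := K t * Psi t j ord0 * Psi t k ord0 * expR (cdot (Psi t) th).
have bf j k : bounded_measurable (f j k).
  apply: bounded_measurableM.
    by do 2 (apply: bounded_measurableM => //).
  by apply: bounded_measurable_exp; exact: bounded_measurable_cdot.
have -> : hess_int th v w = \sum_j w j ord0 * \sum_k v k ord0 * cube_int (f j k).
  transitivity (\sum_j w j ord0 * cube_int (fun t => \sum_k v k ord0 * f j k t)).
    rewrite -cube_int_sum; last first.
      move=> j; apply: bounded_measurable_sum => k; apply: bounded_measurableM => //.
      exact: bounded_measurable_cst.
    congr cube_int; apply/funext => t.
    rewrite (_ : cdot _ w = \sum_j Psi t j ord0 * w j ord0)// mulr_sumr.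
    rewrite (mulr_suml _ _ _ (cdot _ v)) mulr_suml; apply: eq_bigr => j _.
    rewrite (_ : cdot _ v = \sum_k Psi t k ord0 * v k ord0)// mulr_sumr.
    rewrite mulr_suml mulr_sumr; apply: eq_bigr => k _.
    by rewrite /f; ring.
  by apply: eq_bigr => j _; rewrite cube_int_sum.
rewrite mulr_sumr; apply: eq_bigr => j _; rewrite mulrCA mxE; congr (_ * _).
rewrite mulr_sumr; apply: eq_bigr => k _; rewrite mxE /cube_int.
by rewrite /f; ring.
Qed.

Lemma hess_int_ge0 th v : 0 <= hess_int th v v.
Proof.
by apply: cube_int_ge0 => t; rewrite mulr_ge0 ?expR_ge0// -mulrA mulr_ge0// -expr2 sqr_ge0.
Qed.

Lemma score_int_MVT th v w (a b : R) : a < b -> exists2 c, a < c < b &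
  score_int (th + b *: v) w - score_int (th + a *: v) w =
  (b - a) * hess_int (th + c *: v) v w.
Proof.
move=> ab; have H s := is_derive_score_int th v w s.
have cf : {within `[a, b], continuous (fun s => score_int (th + s *: v) w)}.
  apply: continuous_subspaceT => t; apply: differentiable_continuous.
  by apply/derivable1_diffP; case: (H t).
have [c cab E] := MVT ab (fun t _ => H t) cf.
by exists c; [move: cab; rewrite in_itv|rewrite E mulrC].
Qed.

Lemma score_int_le th v (a b : R) : a <= b ->
  score_int (th + a *: v) v <= score_int (th + b *: v) v.
Proof.
rewrite le_eqVlt => /predU1P[->//|ab].
have [c _ E] := score_int_MVT th v v ab.
by rewrite -subr_ge0 E mulr_ge0 ?hess_int_ge0// subr_ge0 ltW.
Qed.

(** * Localisation and expansion of a maximiser [th1], with [gvec] the score at [ths] *)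

Section deviation.
Variables (n : nat) (h : R) (D : 'M[R]_p) (ths th1 gvec : 'cV[R]_p) (r delta : R).
Hypothesis Nh0 : 0 <= n%:R * h ^+ d.
Hypothesis D_pd : sym_posdef D.
Hypothesis r0 : 0 < r.
Hypothesis delta0 : 0 <= delta.
Hypothesis gvecE : forall v,
  cdot gvec v = n%:R * h ^+ d * (score_int th1 v - score_int ths v).
Hypothesis hess_near : forall th, enorm (D *m (th - ths)) <= r ->
  opnorm_le (1%:M - invmx D *m Dn2 n h K Psi th *m invmx D) delta.
Hypothesis gvec_small : enorm (invmx D *m gvec) < r * (1 - delta).

Let Delta := th1 - ths.
Let addDelta : ths + Delta = th1. Proof. by rewrite /Delta addrCA subrr addr0. Qed.
Let u := D *m Delta.
Let Duni := sym_posdef_unit D_pd.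

(** Testing the score increment against [D^-1 w] makes the normalised Hessian of (L0) appear. *)
Let hess_step (s : R) w : 0 < s -> exists2 c, 0 < c < s &
  n%:R * h ^+ d * (score_int (ths + s *: Delta) (invmx D *m w) -
    score_int ths (invmx D *m w)) =
  s * cdot w ((invmx D *m Dn2 n h K Psi (ths + c *: Delta) *m invmx D) *m u).
Proof.
move=> s0; have [c cs E] := score_int_MVT ths Delta (invmx D *m w) s0.
exists c => //; move: E; rewrite scale0r addr0 subr0 => ->.
rewrite mulrCA hess_int_Dn2 -sym_posdef_cdot_inv//.
by rewrite -!mulmxA (mulKmx Duni).
Qed.

Let ball_step (c : R) : 0 <= c -> c * enorm u <= r ->
  enorm (D *m (ths + c *: Delta - ths)) <= r.
Proof.
by move=> c0 cr; rewrite addrAC subrr add0r -scalemxAr enormZ ger0_norm.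
Qed.

(** Otherwise the segment leaves the ball at the fraction [s = r / |u|]. Up to there (L0) makes the
    score grow by at least [s (1 - delta) |u|^2 = r (1 - delta) |u|]. By monotonicity of the score
    along the segment this growth is at most [<gvec, Delta> <= |D^-1 gvec| |u|], contradicting
    [gvec_small]. *)
Lemma mle_in_ball : enorm u <= r.
Proof.
rewrite leNgt; apply/negP => ru.
have u0 : 0 < enorm u := lt_trans r0 ru.
pose s := r / enorm u.
have s0 : 0 < s by rewrite divr_gt0.
have s1 : s <= 1 by rewrite ler_pdivrMr// mul1r ltW.
have [c /andP[c0 cs] E] := hess_step u s0.
have cr : c * enorm u <= r.
  by rewrite -ler_pdivlMr// ltW.
have A := hess_near (ball_step (ltW c0) cr).
set Ac := invmx D *m _ *m _ in E A.
have : cdot u ((1%:M - Ac) *m u) <= delta * enorm u ^+ 2.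
  apply: le_trans (cdot_le_enorm _ _) _.
  by rewrite expr2 mulrCA ler_wpM2l ?enorm_ge0// A.
rewrite mulmxBl mul1mx cdotBr -enorm_sqr => h1.
have h2 : cdot gvec Delta <= enorm (invmx D *m gvec) * enorm u.
  rewrite -[Delta](mulKmx Duni) sym_posdef_cdot_inv//.
  exact: cdot_le_enorm.
have h3 : s * cdot u (Ac *m u) <= cdot gvec Delta.
  rewrite -E gvecE ler_wpM2l// /u (mulKmx Duni) lerD2r.
  by have := score_int_le ths Delta s1; rewrite scale1r addDelta.
have : s * (enorm u ^+ 2 * (1 - delta)) <= enorm (invmx D *m gvec) * enorm u.
  apply: le_trans h2; apply: le_trans h3; rewrite ler_wpM2l ?(ltW s0)//.
  by rewrite mulrBr mulr1; lra.
rewrite (_ : s * _ = r * (1 - delta) * enorm u); last first.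
  by rewrite /s; field; rewrite gt_eqF.
by rewrite ler_pM2r// leNgt gvec_small.
Qed.

Lemma mle_expansion : enorm (u - invmx D *m gvec) <= r * delta.
Proof.
set x := u - _.
have [x0|x0] := eqVneq x 0.
  rewrite x0 /enorm cdot0l sqrtr0 mulr_ge0 ?(ltW r0)//.
have [c /andP[c0 c1] E] := hess_step x ltr01.
have cr : c * enorm u <= r.
  by apply: le_trans mle_in_ball; rewrite ler_piMl ?enorm_ge0// ltW.
have A := hess_near (ball_step (ltW c0) cr).
set Ac := invmx D *m _ *m _ in E A.
have E2 : cdot x (invmx D *m gvec) = cdot x (Ac *m u).
  rewrite sym_posdef_cdot_inv// cdotC gvecE -[RHS]mul1r -E scale1r.
  by rewrite addDelta.
have E3 : enorm x ^+ 2 = cdot x ((1%:M - Ac) *m u).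
  by rewrite enorm_sqr {2}/x cdotBr E2 mulmxBl mul1mx cdotBr.
have : enorm x ^+ 2 <= enorm x * (delta * enorm u).
  rewrite E3; apply: le_trans (cdot_le_enorm _ _) _.
  by rewrite ler_wpM2l ?enorm_ge0// A.
rewrite expr2 ler_pM2l ?enorm_gt0// => h1; apply: le_trans h1 _.
by rewrite mulrC ler_wpM2r// mle_in_ball.
Qed.

End deviation.
End normaliser.

(** * Expectations of bounded random variables *)

Lemma derive_at_max_eq0 (R : realType) (F dF : R -> R) :
  (forall s : R, is_derive s 1 F (dF s)) -> (forall s, F s <= F 0) -> dF 0 = 0.
Proof.
move=> FdF Fmax.
have h : is_derive (0 : R) 1 F 0.
  apply: (@derive1_at_max _ F (-1) 1 0) => //.
  by rewrite in_itv/= ltrN10 ltr01.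
by rewrite -(@derive_val _ _ _ _ _ _ _ (FdF 0)) (@derive_val _ _ _ _ _ _ _ h).
Qed.

Section expectation.
Context {R : realType} dT {Omega : measurableType dT} (P : probability Omega R).
Implicit Types f g : Omega -> R.

Lemma bounded_measurable_integrable f : bounded_measurable f ->
  P.-integrable setT (EFin \o f).
Proof.
move=> [mf [M fM]]; have MP : P.-integrable setT (EFin \o cst M).
  apply/integrableP; split; first exact/measurable_EFinP.
  under eq_integral do rewrite /=.
  rewrite integral_cst// [X in (_ * X)%E](_ : _ = 1%E) ?mule1 ?ltry//.
  exact: probability_setT.
apply: le_integrable MP => //; first exact/measurable_EFinP.
by move=> w _ /=; rewrite lee_fin (le_trans (fM w))// ler_norm.
Qed.

Lemma Rintegral_affine (I : Type) (r : seq I) (a : I -> R) (f : I -> Omega -> R) (c : R) :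
  (forall i, bounded_measurable (f i)) ->
  Rintegral P setT (fun w => \sum_(i <- r) a i * f i w + c) =
  \sum_(i <- r) a i * Rintegral P setT (f i) + c.
Proof.
move=> bf; elim: r => [|i r IH].
  under eq_Rintegral do rewrite big_nil add0r.
  rewrite big_nil add0r Rintegral_cst// [X in fine X](_ : _ = 1%E) ?mulr1//.
  exact: probability_setT.
under eq_Rintegral do rewrite big_cons -addrA.
have b1 := bounded_measurableM (bounded_measurable_cst _ (a i)) (bf i).
have b2 : bounded_measurable (fun w => \sum_(j <- r) a j * f j w + c).
  apply: bounded_measurableD; last exact: bounded_measurable_cst.
  apply: bounded_measurable_sum => j.
  exact: bounded_measurableM (bounded_measurable_cst _ (a j)) (bf j).
rewrite RintegralD//; [|exact: bounded_measurable_integrable..].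
rewrite IH RintegralZl ?big_cons ?addrA//.
exact: bounded_measurable_integrable.
Qed.

Lemma EFin_Rintegral f : bounded_measurable f ->
  (\int[P]_w (f w)%:E = (Rintegral P setT f)%:E)%E.
Proof.
move=> bf; rewrite fineK//; apply: integrable_fin_num => //.
exact: bounded_measurable_integrable.
Qed.

(** Averaging the hypothesis over [lam] and [- lam] gives [1 + lam^2 / 2 <= exp(nu^2 lam^2 / 2)];
    comparing second-order terms for small [lam] excludes [nu < 1]. *)
Lemma subgaussian_factor_ge1 f (nu g : R) : 0 < nu -> 0 < g -> bounded_measurable f ->
  Rintegral P setT (fun w => f w * f w) = 1 ->
  (forall lam, `|lam| <= g ->
    (\int[P]_w (expR (lam * f w))%:E <= (expR (nu ^+ 2 * lam ^+ 2 / 2))%:E)%E) ->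
  1 <= nu.
Proof.
move=> nu0 g0 bf f1 fexp; rewrite leNgt; apply/negP => nu1.
have be lam : bounded_measurable (fun w => expR (lam * f w)).
  apply: bounded_measurable_exp; apply: bounded_measurableM => //.
  exact: bounded_measurable_cst.
have H lam : 0 <= lam <= g -> 1 + lam ^+ 2 / 2 <= expR (nu ^+ 2 * lam ^+ 2 / 2).
  move=> /andP[l0 lg].
  have := fexp lam; have := fexp (- lam).
  rewrite normrN ger0_norm// sqrrN !EFin_Rintegral// !lee_fin => /(_ lg) h1 /(_ lg) h2.
  have h : Rintegral P setT (fun w => lam ^+ 2 / 2 * (f w * f w) + 1) <=
     Rintegral P setT (fun w => (2^-1 * expR (lam * f w) + 2^-1 * expR (- lam * f w))).
    apply: le_Rintegral => //.
    - apply: bounded_measurable_integrable.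
      apply: bounded_measurableD; last exact: bounded_measurable_cst.
      apply: bounded_measurableM; last exact: bounded_measurableM.
      exact: bounded_measurable_cst.
    - apply: bounded_measurable_integrable; apply: bounded_measurableD;
      apply: bounded_measurableM => //; exact: bounded_measurable_cst.
    - move=> w _; have := cosh_ge (lam * f w); rewrite mulNr exprMn -expr2.
      lra.
  move: h.
  have := @Rintegral_affine _ [:: tt] (fun _ => lam ^+ 2 / 2) (fun _ w => f w * f w) 1
    (fun _ => bounded_measurableM bf bf).
  under eq_Rintegral do rewrite big_seq1; rewrite big_seq1 => ->.
  have := @Rintegral_affine _ [:: true; false] (fun _ => 2^-1)
    (fun b w => expR ((if b then lam else - lam) * f w)) 0 (fun b => be _).
  under eq_Rintegral do rewrite big_cons big_seq1 addr0.
  rewrite big_cons big_seq1 addr0/= => ->.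
  by rewrite f1; lra.
(* Small enough that [v = lam^2 / 2 < 1 - nu^2], which contradicts [(1 + v) (1 - nu^2 v) <= 1]. *)
pose lam := Num.min g (1 - nu ^+ 2).
have nu2 : 0 < 1 - nu ^+ 2 by rewrite subr_gt0 exprn_ilt1// ltW.
have lam0 : 0 < lam by rewrite lt_min g0.
have lamg : lam <= g by rewrite ge_min lexx.
have lamn : lam <= 1 - nu ^+ 2 by rewrite ge_min lexx orbT.
have nn : 0 < nu ^+ 2 by rewrite exprn_gt0.
have := H lam; rewrite (ltW lam0) lamg => /(_ isT).
pose v := lam ^+ 2 / 2.
have v0 : 0 < v by rewrite divr_gt0// exprn_gt0.
have vn : v < 1 - nu ^+ 2.
  have : lam ^+ 2 <= lam * (1 - nu ^+ 2) by rewrite expr2 ler_wpM2l// ltW.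
  have : lam * (1 - nu ^+ 2) <= 1 * (1 - nu ^+ 2) by rewrite ler_wpM2r ?ltW//; lra.
  by rewrite /v; lra.
rewrite -/v -mulrA -/v.
have := expR_ge1Dx (- (nu ^+ 2 * v)); have := expRxMexpNx_1 (nu ^+ 2 * v).
have := expR_gt0 (- (nu ^+ 2 * v)).
set a := expR _; set b := expR _ => a0 ba h1 h2.
have h3 : (1 + v) * a <= 1 by rewrite -[leRHS]ba ler_wpM2r// ltW.
have h4 : (1 + v) * (1 - nu ^+ 2 * v) <= 1.
  by apply: le_trans h3; apply: ler_wpM2l => //; lra.
have h5 : nu ^+ 2 * v <= v by rewrite ler_piMl ?ltW//; lra.
have h6 : 0 < v * (1 - nu ^+ 2 - v) by rewrite mulr_gt0// subr_gt0.
have h7 : v * (nu ^+ 2 * v) <= v * v by rewrite ler_wpM2l// ltW.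
lra.
Qed.

End expectation.

Section rescale.
Context {R : realType} dT {Omega : measurableType dT} (d : nat).

Lemma measurable_rescale (x0 : d.-tuple R) (h : R) (X : Omega -> d.-tuple R) :
  measurable_fun setT X -> measurable_fun setT (fun w => rescale x0 h (X w)).
Proof.
move=> mX; apply/measurable_fun_tnthP => k.
rewrite (_ : _ \o _ = fun w => (tnth (X w) k - tnth x0 k) / h); last first.
  by apply/funext => w; rewrite /= tnth_mktuple.
apply: measurable_funM => //; apply: measurable_funB => //.
exact: (measurableT_comp (measurable_tnth _) mX).
Qed.

Lemma bounded_measurable_comp (f : d.-tuple R -> R) (X : Omega -> d.-tuple R) :
  bounded_measurable f -> measurable_fun setT X -> bounded_measurable (fun w => f (X w)).
Proof.
by move=> [mf [M fM]] mX; split; [exact: measurableT_comp|exists M => w; exact: fM].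
Qed.

End rescale.

(** * Assembly of the deterministic and probabilistic parts *)

Theorem theorem2
  (R : realType) (dT : measure_display) (Omega : measurableType dT)
  (P : probability Omega R)
  (d p n : nat) (hd : (0 < d)%N) (hp : (0 < p)%N) (hn : (0 < n)%N)
  (h : R) (hh : 0 < h) (x0 : d.-tuple R)
  (f : d.-tuple R -> R)
  (X : 'I_n -> Omega -> d.-tuple R)
  (K : d.-tuple R -> R)
  (Psi : d.-tuple R -> 'cV[R]_p)
  (* density f *)
  (f_ge0 : forall x, 0 <= f x)
  (f_meas : measurable_fun [set: d.-tuple R] f)
  (* X_1, ..., X_n are measurable, i.i.d. with Lebesgue density f :
     the joint law of (X_1,...,X_n) is the product of the laws f(x) dx,
     checked on the generating pi-system of measurable rectangles *)
  (X_meas : forall i, measurable_fun [set: Omega] (X i))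
  (X_iid : forall B : 'I_n -> 'I_d -> set R,
      (forall i k, measurable (B i k)) ->
      P [set w | forall i k, B i k (tnth (X i w) k)] =
      (\prod_(i < n) leb_int_nneg (fun t => (\1_(boxset (B i)) t * f t)%:E))%E)
  (* kernel K *)
  (K_ge0 : forall t, 0 <= K t)
  (K_meas : measurable_fun [set: d.-tuple R] K)
  (K_bnd : exists M : R, forall t, K t <= M)
  (K_supp : forall t, ~ cube t -> K t = 0)
  (* basis functions *)
  (Psi_meas : forall j, measurable_fun [set: d.-tuple R] (fun t => Psi t j ord0))
  (Psi_bnd : exists M : R, forall t j, `|Psi t j ord0| <= M)
  (Psi_supp : forall t, ~ cube t -> Psi t = 0)
  (Psi0 : forall t, cube t -> Psi t (Ordinal hp) ord0 = 1)
  (Psi_indep : forall c : 'cV[R]_p,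
      (forall t, cube t -> 0 < K t -> cdot (Psi t) c = 0) -> c = 0)
  (* local log-likelihood and its expectation *)
  (L := fun th w => loglik h x0 K Psi (fun i => X i w) th)
  (EL := fun th => (\int[P]_w (L th w)%:E)%E)
  (* MLE and its target *)
  (tht : Omega -> 'cV[R]_p)
  (tht_max : forall w th, L th w <= L (tht w) w)
  (ths : 'cV[R]_p)
  (ths_max : forall th, (EL th <= EL ths)%E)
  (* score and its covariance matrix *)
  (gradL := fun w => grad (fun th => L th w) ths)
  (Egrad := \col_(j < p) Rintegral P [set: Omega] (fun w => gradL w j ord0))
  (Vn2 := \matrix_(j, k) Rintegral P [set: Omega]
            (fun w => (gradL w j ord0 - Egrad j ord0) *
                      (gradL w k ord0 - Egrad k ord0)))
  (Vn2_pd : sym_posdef Vn2)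
  (* D_n, V_n: the symmetric positive definite square roots *)
  (D V : 'M[R]_p)
  (D_pd : sym_posdef D) (D_sq : D *m D = Dn2 n h K Psi ths)
  (V_pd : sym_posdef V) (V_sq : V *m V = Vn2)
  (xi := fun w => invmx D *m gradL w)
  (* constants *)
  (a nu0 g z delta : R)
  (ha : 0 < a) (hnu0 : 0 < nu0) (hg : 0 < g)
  (zeta := a * nu0 * (Num.sqrt p%:R + Num.sqrt (2 * z)))
  (r0 := 4 * a * nu0 * (Num.sqrt p%:R + Num.sqrt (2 * z)))
  (Theta := [set th : 'cV[R]_p | enorm (D *m (th - ths)) <= r0])
  (hz : 0 < z) (hzg : z <= g ^+ 2 / 4)
  (* (I) *)
  (condI : loewner_le Vn2 (a ^+ 2 *: (D *m D)))
  (* (ED0) *)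
  (zeta_vec := fun w => invmx V *m gradL w -
       \col_(j < p) Rintegral P [set: Omega] (fun w' => (invmx V *m gradL w') j ord0))
  (condED0 : forall (gam : 'cV[R]_p) (lam : R), gam != 0 -> `|lam| <= g ->
      (\int[P]_w (expR (lam * cdot gam (zeta_vec w) / enorm gam))%:E
        <= (expR (nu0 ^+ 2 * lam ^+ 2 / 2))%:E)%E)
  (* (L0) *)
  (hdelta : 0 <= delta)
  (condL0 : forall th, Theta th ->
      opnorm_le (1%:M - invmx D *m Dn2 n h K Psi th *m invmx D) delta)
  (* (C) *)
  (condC : r0 * (1 - delta) >= 2 * zeta) :
  exists A : set Omega, measurable A /\
    A `<=` [set w | Theta (tht w) /\
                    enorm (D *m (tht w - ths) - xi w) <= r0 * delta] /\
    ((1 - (2 * expR (- z) + (84%:R / 10%:R) * expR (- (g ^+ 2 / 4))))%:E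
       <= P A)%E.

Proof.
have bK : bounded_measurable K.
  by case: K_bnd => M KM; split => //; exists M => t; rewrite ger0_norm.
have bPsi j : bounded_measurable (fun t => Psi t j ord0).
  by case: Psi_bnd => M PM; split => //; exists M => t; exact: PM.
pose N : R := n%:R * h ^+ d.
have N0 : 0 <= N by rewrite mulr_ge0// exprn_ge0// ltW.
(* The data enter the log-likelihood only through the linear statistic [S]. *)
pose S w : 'cV[R]_p := \col_j \sum_(i < n)
  K (rescale x0 h (X i w)) * Psi (rescale x0 h (X i w)) j ord0.
have bS j : bounded_measurable (fun w => S w j ord0).
  rewrite (_ : (fun w => _) = fun w => \sum_(i < n)
    K (rescale x0 h (X i w)) * Psi (rescale x0 h (X i w)) j ord0); last first.
    by apply/funext => w; rewrite mxE.
  apply: bounded_measurable_sum => i; apply: bounded_measurableM.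
    exact: (bounded_measurable_comp bK (measurable_rescale x0 h (X_meas i))).
  exact: (bounded_measurable_comp (bPsi j) (measurable_rescale x0 h (X_meas i))).
have LE th w : L th w = cdot (S w) th - N * norm_int K Psi th.
  rewrite /L /loglik; congr (_ - _); rewrite /cdot.
  under [RHS]eq_bigr do rewrite mxE mulr_suml.
  rewrite exchange_big/=; apply: eq_bigr => i _; rewrite mulr_sumr.
  by apply: eq_bigr => j _; rewrite mulrA.
have dL w th v (s : R) : is_derive s 1 (fun s => L (th + s *: v) w)
    (cdot (S w) v - N * score_int K Psi (th + s *: v) v).
  have := is_derive_linear_sub_norm_int bK bPsi (S w) th v N s.
  by congr (is_derive _ _ _ _); apply/funext => r; rewrite LE.
have gradE w j : gradL w j ord0 = S w j ord0 - N * score_int K Psi ths (delta_mx j ord0).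
  rewrite mxE derive1E (@derive_val _ _ _ _ _ _ _ (dL w ths (delta_mx j ord0) 0)).
  by rewrite scale0r addr0 cdot_delta.
have gradv w v : cdot (gradL w) v = cdot (S w) v - N * score_int K Psi ths v.
  rewrite (score_int_sum bK bPsi ths v) mulr_sumr -sumrB.
  by apply: eq_bigr => j _; rewrite gradE; ring.
have mleE w v : cdot (S w) v = N * score_int K Psi (tht w) v.
  apply/eqP; rewrite -subr_eq0; apply/eqP.
  have := derive_at_max_eq0 (dL w (tht w) v).
  by rewrite scale0r addr0; apply => s; exact: tht_max.
(* The expected log-likelihood has the same form with [ES] for [S], so maximality of [ths] makes the
   score at [ths] centred. *)
pose ES : 'cV[R]_p := \col_j Rintegral P setT (fun w => S w j ord0).
have ELE th : EL th = (cdot ES th - N * norm_int K Psi th)%:E.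
  have bL : bounded_measurable (fun w =>
      \sum_j th j ord0 * S w j ord0 + - (N * norm_int K Psi th)).
    apply: bounded_measurableD; last exact: bounded_measurable_cst.
    apply: bounded_measurable_sum => j.
    exact: bounded_measurableM (bounded_measurable_cst _ _) (bS j).
  rewrite /EL (_ : (fun w => _) =
      EFin \o (fun w => \sum_j th j ord0 * S w j ord0 + - (N * norm_int K Psi th))).
    rewrite [LHS](EFin_Rintegral P bL) Rintegral_affine//; congr (_ + _)%:E.
    by apply: eq_bigr => j _; rewrite mxE mulrC.
  apply/funext => w /=; rewrite LE; congr (_ + _)%:E.
  by apply: eq_bigr => j _; rewrite mulrC.
have ESE j : ES j ord0 = N * score_int K Psi ths (delta_mx j ord0).
  apply/eqP; rewrite -subr_eq0; apply/eqP.
  have := derive_at_max_eq0 (is_derive_linear_sub_norm_int bK bPsi ES ths (delta_mx j ord0) N).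
  rewrite scale0r addr0 cdot_delta; apply => s.
  by rewrite -lee_fin -!ELE; exact: ths_max.
have bgrad j : bounded_measurable (fun w => gradL w j ord0).
  under eq_fun do rewrite gradE.
  exact: bounded_measurableD (bS j) (bounded_measurable_cst _ _).
have Egrad0 j : Rintegral P setT (fun w => gradL w j ord0) = 0.
  under eq_Rintegral do rewrite gradE.
  have := Rintegral_affine P [:: j] (fun=> 1) (- (N * score_int K Psi ths (delta_mx j ord0))) bS.
  under eq_Rintegral do rewrite big_seq1 mul1r.
  move=> ->; rewrite big_seq1 mul1r -ESE mxE subrr //.
have zetaE w : zeta_vec w = invmx V *m gradL w.
  rewrite /zeta_vec; apply/matrixP => j i; rewrite ord1 !mxE.
  rewrite (_ : Rintegral _ _ _ = 0) ?subr0//.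
  transitivity (Rintegral P setT (fun w' => \sum_k invmx V j k * gradL w' k ord0 + 0)).
    by apply: eq_Rintegral => w' _; rewrite mxE addr0.
  by rewrite Rintegral_affine// addr0 big1// => k _; rewrite Egrad0 mulr0.
have ED0 (gam : 'cV[R]_p) (lam : R) : gam != 0 -> `|lam| <= g ->
    (\int[P]_w (expR (lam * (cdot gam (invmx V *m gradL w) / enorm gam)))%:E
      <= (expR (nu0 ^+ 2 * lam ^+ 2 / 2))%:E)%E.
  move=> gam0 lamg; have := condED0 _ _ gam0 lamg.
  by under eq_integral do rewrite zetaE -mulrA.
have Vuni := sym_posdef_unit V_pd.
(* The direction [V e0] is chosen because its product with [V^-1 gradL] is one coordinate of the
   score, with second moment [|V e0|^2]; normalising gives a variable with unit second moment. *)
have nu1 : 1 <= nu0.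
  pose j0 := Ordinal hp; pose e0 : 'cV[R]_p := delta_mx j0 ord0.
  have e0_neq0 : e0 != 0.
    apply/eqP => /(congr1 (fun u : 'cV[R]_p => u j0 ord0)); rewrite !mxE !eqxx.
    by move/eqP; rewrite oner_eq0.
  have gam0 : V *m e0 != 0.
    by apply/negP => /eqP Ve; have := (proj2 V_pd) _ e0_neq0; rewrite Ve cdotC cdot0l ltxx.
  have q0 : 0 < enorm (V *m e0) by rewrite enorm_gt0.
  have gamE w : cdot (V *m e0) (invmx V *m gradL w) = gradL w j0 ord0.
    by rewrite -sym_posdef_cdot// mulKVmx// cdotC cdot_delta.
  have qE : enorm (V *m e0) ^+ 2 = Rintegral P setT (fun w => gradL w j0 ord0 * gradL w j0 ord0).
    rewrite enorm_sqr -sym_posdef_cdot// mulmxA V_sq cdotC cdot_delta -colE !mxE.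
    by apply: eq_Rintegral => w _; rewrite Egrad0 subr0.
  have bf : bounded_measurable (fun w => (enorm (V *m e0))^-1 * gradL w j0 ord0).
    exact: bounded_measurableM (bounded_measurable_cst _ _) (bgrad j0).
  apply: (subgaussian_factor_ge1 hnu0 hg bf).
    have := Rintegral_affine P [:: tt] (fun=> (enorm (V *m e0)) ^- 2) 0
      (fun _ => bounded_measurableM (bgrad j0) (bgrad j0)).
    under eq_Rintegral do rewrite big_seq1 addr0.
    rewrite big_seq1 addr0 -qE mulVf ?expf_neq0 ?gt_eqF// => <-.
    by apply: eq_Rintegral => w _; rewrite expr2 invfM; ring.
  move=> lam lamg; have := ED0 _ _ gam0 lamg.
  by under eq_integral do rewrite gamE [_ / enorm _]mulrC.
pose Y w : 'cV[R]_p := nu0^-1 *: (invmx V *m gradL w).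
have mY j : measurable_fun setT (fun w => Y w j ord0).
  suff : bounded_measurable (fun w => Y w j ord0) by case.
  rewrite (_ : (fun w => _) = fun w => nu0^-1 * \sum_k invmx V j k * gradL w k ord0); last first.
    by apply/funext => w; rewrite !mxE.
  apply: bounded_measurableM; first exact: bounded_measurable_cst.
  apply: bounded_measurable_sum => k.
  exact: bounded_measurableM (bounded_measurable_cst _ _) (bgrad k).
have Yexp (x : 'cV[R]_p) : cdot x x <= g ^+ 2 ->
    (\int[P]_w (expR (cdot x (Y w)))%:E <= (expR (cdot x x / 2))%:E)%E.
  move=> xg; have [->|x_neq0] := eqVneq x 0.
    under eq_integral do rewrite cdot0l expR0.
    rewrite cdot0l mul0r expR0 integral_cst// mul1e.
    exact: probability_le1.
  have x0_gt0 : 0 < enorm x by rewrite enorm_gt0.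
  (* (ED0) is used at [lam = |x| / nu0], which stays within [g] because [nu0 >= 1]. *)
  have lamg : `|enorm x / nu0| <= g.
    rewrite ger0_norm ?divr_ge0 ?enorm_ge0 ?(ltW hnu0)// ler_pdivrMr//.
    apply: (@le_trans _ _ g); last by rewrite ler_peMr// ltW.
    by rewrite -ler_sqr ?nnegrE ?enorm_ge0 ?(ltW hg)// enorm_sqr.
  have := ED0 _ _ x_neq0 lamg.
  rewrite (_ : nu0 ^+ 2 * (enorm x / nu0) ^+ 2 / 2 = cdot x x / 2); last first.
    by rewrite -enorm_sqr; field; rewrite gt_eqF.
  apply: le_trans; rewrite le_eqVlt; apply/orP; left; apply/eqP.
  apply: eq_integral => w _; congr (expR _)%:E; rewrite /Y cdotZr.
  by field; rewrite !gt_eqF.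
have tail := subgaussian_norm_tail mY Yexp hg hz hzg hp.
set B := [set w | _] in tail.
have mB : measurable B.
  apply: measurable_ge_set; apply: measurableT_comp (measurable_cdot_sqr mY).
  exact: continuous_measurable_fun (@sqrt_continuous _).
rewrite -V_sq in condI.
have Dbound w : enorm (xi w) <= a * nu0 * enorm (Y w).
  have -> : a * nu0 * enorm (Y w) = a * enorm (invmx V *m gradL w).
    rewrite enormZ ger0_norm ?invr_ge0 ?(ltW hnu0)//.
    by field; rewrite gt_eqF.
  exact: enorm_loewner_le D_pd V_pd ha _.
have zeta0 : 0 < zeta.
  rewrite mulr_gt0 ?mulr_gt0// ltr_wpDr ?sqrtr_ge0// sqrtr_gt0 ltr0n//.
have r00 : r0 = 4 * zeta by rewrite /r0 /zeta; ring.
(* The good event is defined through [Y] alone, hence measurable; on it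
   [|xi| <= a nu0 |Y| < 2 zeta], and (C) supplies the smallness needed by the deterministic part. *)
exists (~` B); split; first exact: measurableC.
split.
  move=> w; rewrite /B/= => /negP; rewrite -ltNge => Yw.
  have small : enorm (invmx D *m gradL w) < r0 * (1 - delta).
    apply: (@lt_le_trans _ _ (2 * zeta)) condC.
    apply: le_lt_trans (Dbound w) _.
    rewrite /zeta mulrCA ltr_pM2l ?mulr_gt0//.
  have r0_gt0 : 0 < r0 by rewrite r00 mulr_gt0.
  have gvecE v : cdot (gradL w) v = N * (score_int K Psi (tht w) v - score_int K Psi ths v).
    by rewrite gradv mleE mulrBr.
  have near th : enorm (D *m (th - ths)) <= r0 ->
      opnorm_le (1%:M - invmx D *m Dn2 n h K Psi th *m invmx D) delta.
    exact: condL0.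
  split.
    exact: (mle_in_ball bK K_ge0 bPsi N0 D_pd r0_gt0 gvecE near small).
  exact: (mle_expansion bK K_ge0 bPsi N0 D_pd r0_gt0 hdelta gvecE near small).
rewrite probability_setC//.
move: tail; rewrite -[P B]fineK ?fin_num_measure// -EFinB !lee_fin => tail.
by rewrite lerD2l lerN2.
Qed.
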